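(* Let $d\ge1$, $m>1$, $T>0$, $C>0$, and set $\alpha:=\frac{d}{d(m-1)+2}$, $k:=\frac{\alpha(m-1)}{2md}$, $\beta:=\frac{\alpha}{d}$. Consider the Barenblatt solution $$u_{BB}(t,x):=t^{-\alpha}\left(C-k|xt^{-\beta}|^2\right)_+^{\frac{1}{m-1}},\qquad t>0,\ x\in\mathbb{R}^d.$$ Let $\mu\in[1,m]$ and $s>0$. If $u_{BB}^{[\mu]}\in L^{\frac m\mu}(0,T;\dot W^{s,\frac m\mu}(\mathbb{R}^d))$, then $s<\frac{2\mu}{m}$.
   Context: Notation: $u^{[\mu]}:=|u|^{\mu-1}u$ and $(a)_+:=\max\{a,0\}$. Homogeneous Sobolev–Slobodeckij (semi)norms: for $p\in[1,\infty)$ and non-integer $s=j+r$ with $j\in\mathbb{N}_0$, $r\in(0,1)$, $$\|g\|_{\dot W^{s,p}(\mathbb{R}^d)}:=\left(\int_{\mathbb{R}^d\times\mathbb{R}^d}\frac{|D^jg(x)-D^jg(y)|^p}{|x-y|^{rp+d}}\,dx\,dy\right)^{1/p};$$ for integer $j$, $\|g\|_{\dot W^{j,p}(\mathbb{R}^d)}:=\|D^jg\|_{L^p(\mathbb{R}^d)}$. $\dot W^{s,p}(\mathbb{R}^d)$ consists of the locally integrable functions for which this is finite. *)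

(* Defs.v *)
From HB Require Import structures.
From mathcomp Require Import all_boot all_order all_algebra.
From mathcomp Require Import all_classical all_reals all_analysis.

Set Implicit Arguments.
Unset Strict Implicit.
Unset Printing Implicit Defensive.
Import Order.TTheory GRing.Theory Num.Theory.
Import numFieldNormedType.Exports.

Local Open Scope classical_set_scope.
Local Open Scope ring_scope.

(* R^d is 'rV[R]_d.  Its topology is the library's (sup norm); its            *)
(* sigma-algebra is the one generated by the coordinates, as for n.-tuple,    *)
(* which is the Borel sigma-algebra of R^d.                                   *)

Definition measure_rV_display : measure_display -> measure_display.
Proof. exact. Qed.

Section measurable_rV.
Context {disp} {T : measurableType disp}.
Variable n : nat.

Definition rV_coord (i : 'I_n) (x : 'rV[T]_n) : T := x ord0 i.

Let rV_set0 : g_sigma_preimage rV_coord set0.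
Proof. exact: sigma_algebra0. Qed.

Let rV_setC A : g_sigma_preimage rV_coord A -> g_sigma_preimage rV_coord (~` A).
Proof. exact: sigma_algebraC. Qed.

Let rV_bigcup (F : _^nat) : (forall i, g_sigma_preimage rV_coord (F i)) ->
  g_sigma_preimage rV_coord (\bigcup_i (F i)).
Proof. exact: sigma_algebra_bigcup. Qed.

HB.instance Definition _ := @isMeasurable.Build (measure_rV_display disp)
  'rV[T]_n (g_sigma_preimage rV_coord) rV_set0 rV_setC rV_bigcup.

End measurable_rV.

Lemma measurable_fun_rVP d1 d2 (T1 : measurableType d1) (T2 : measurableType d2)
    n (f : T1 -> 'rV[T2]_n) :
  measurable_fun [set: T1] f <->
  forall i, measurable_fun [set: T1] (@rV_coord _ T2 n i \o f).
Proof.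
apply: (@iff_trans _ (g_sigma_preimage
    (fun i => @rV_coord _ T2 n i \o f) `<=` measurable)).
  rewrite g_sigma_preimage_comp; split=> [mf A [/= B preB <-]|prefS].
    exact: mf.
  by move=> _ A mA; apply: prefS; exists A.
split=> [coordfS i|mf].
- move=> _ A mA.
  apply: coordfS; apply: sub_sigma_algebra.
  case: n i => [[] []//|n i] in f *.
  rewrite -bigcup_mkord_ord.
  exists i; first exact: ltn_ord.
  by exists A => //; rewrite inord_val.
- apply: smallest_sub; first exact: sigma_algebra_measurable.
  case: n => [|n] in f mf *; first by rewrite big_ord0.
  rewrite -bigcup_mkord_ord; apply: bigcup_sub => i Ii.
  by move=> A [B mB <-]; exact: mf.
Qed.

Lemma measurable_rV_coord d1 (T1 : measurableType d1) n i :
  measurable_fun [set: 'rV[T1]_n] (@rV_coord _ T1 n i).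
Proof.
have /measurable_fun_rVP := @measurable_id _ 'rV[T1]_n setT; exact.
Qed.

Section rV_cons.
Context {R : realType}.
Variable n : nat.

Definition rV_cons (x : R * 'rV[R]_n) :
  'rV[R]_n.+1 :=
  \row_i (if unlift ord0 i is Some j then x.2 ord0 j else x.1).

Definition rV_uncons (x : 'rV[R]_n.+1) :
  R * 'rV[R]_n :=
  (x ord0 ord0, \row_j x ord0 (lift ord0 j)).

Lemma rV_consK : cancel rV_cons rV_uncons.
Proof.
case=> a v; rewrite /rV_uncons /rV_cons !mxE unlift_none /=; congr pair.
by apply/rowP => j; rewrite !mxE liftK.
Qed.

Lemma measurable_rV_cons : measurable_fun setT rV_cons.
Proof.
apply/measurable_fun_rVP => i.
rewrite (_ : _ \o _ = fun x => if unlift ord0 i is Some j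
    then rV_coord j x.2 else x.1); last first.
  by apply/funext => x; rewrite /= /rV_coord mxE.
case: unliftP => [j _|_]; last exact: measurable_fst.
exact: (measurableT_comp (measurable_rV_coord j) measurable_snd).
Qed.

Lemma measurable_rV_uncons : measurable_fun setT rV_uncons.
Proof.
apply/measurable_fun_pairP; split; first exact: (measurable_rV_coord ord0).
apply/measurable_fun_rVP => i.
rewrite (_ : _ \o _ = rV_coord (lift ord0 i)); last first.
  by apply/funext => x; rewrite /= /rV_coord mxE.
exact: measurable_rV_coord.
Qed.

End rV_cons.

Section lebesgue_rV_step.
Local Open Scope ereal_scope.
Context {R : realType} {n : nat}.
Variable mu : {sigma_finite_measure set 'rV[R]_n -> \bar R}.

Definition lebesgue_rV_step : set 'rV[R]_n.+1 -> \bar R :=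
  pushforward (@lebesgue_measure R \x mu) (@rV_cons R n).

HB.instance Definition _ := Measure.copy lebesgue_rV_step
  (@measure_function_pushforward__canonical__measure_function_Measure
     _ _ _ _ _ (@lebesgue_measure R \x mu) _ (@measurable_rV_cons R n)).

Let lebesgue_rV_step_sigma_finite : sigma_finite setT lebesgue_rV_step.
Proof.
have /sigma_finiteP[F [TF ndF Foo]] := sigma_finiteT (@lebesgue_measure R).
have /sigma_finiteP[G [TG ndG Goo]] := sigma_finiteT mu.
exists (fun k => @rV_uncons R n @^-1` (F k `*` G k)).
  rewrite -preimage_bigcup; apply/esym/seteqP; split=> // x _.
  have [k _ Fk] : (\bigcup_i F i) (rV_uncons x).1 by rewrite -TF.
  have [l _ Gl] : (\bigcup_i G i) (rV_uncons x).2 by rewrite -TG.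
  exists (maxn k l) => //; split.
    by move: Fk; exact/subsetPset/ndF/leq_maxl.
  by move: Gl; exact/subsetPset/ndG/leq_maxr.
move=> k; have [mF Fk] := Foo k; have [mG Gk] := Goo k; split.
  rewrite -[X in measurable X]setTI; apply: measurable_rV_uncons => //.
  exact: measurableX.
rewrite /lebesgue_rV_step /pushforward -comp_preimage.
rewrite (_ : _ \o _ = id) ?preimage_id; last first.
  by apply/funext => x; exact: rV_consK.
by rewrite product_measure1E// lte_mul_pinfty// ge0_fin_numE.
Qed.

HB.instance Definition _ := Measure_isSigmaFinite.Build _ _ _
  lebesgue_rV_step lebesgue_rV_step_sigma_finite.

End lebesgue_rV_step.

(* Lebesgue measure on R^n: the n-fold product of Lebesgue measure on R. *)
Fixpoint lebesgue_rV (R : realType) (n : nat) :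
    {sigma_finite_measure set 'rV[R]_n -> \bar R} :=
  match n with
  | 0 => dirac (0%R : 'rV[R]_0)
  | k.+1 => lebesgue_rV_step (lebesgue_rV R k)
  end.

Section sobolev_slobodeckij.
Context {R : realType} {d : nat}.
Local Notation Rd := 'rV[R]_d.
Local Notation leb := (lebesgue_rV R d).
Implicit Types (f g : Rd -> R) (x y : Rd) (p r s T : R).

(* Euclidean norm; the library norm on 'rV is the sup norm *)
Definition enorm x : R := Num.sqrt (\sum_(i < d) x ord0 i ^+ 2).

Definition partial (i : 'I_d) f : Rd -> R :=
  fun x => 'D_(delta_mx ord0 i) f x.

Definition iter_partial (w : seq 'I_d) f : Rd -> R := foldr partial f w.

Definition smooth f := forall w : seq 'I_d, continuous (iter_partial w f) /\
  forall x i, derivable (iter_partial w f) x (delta_mx ord0 i).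

Definition test_function f :=
  smooth f /\ compact (closure [set x | f x != 0]).

Definition locally_integrable_rV f := measurable_fun setT f /\
  forall K : set Rd, compact K ->
    (\int[leb]_(x in K) `|f x|%:E < +oo)%E.

Definition weak_derivative (w : seq 'I_d) g h :=
  [/\ locally_integrable_rV g, locally_integrable_rV h &
    forall phi, test_function phi ->
      \int[leb]_x (g x * iter_partial w phi x) =
      (-1) ^+ size w * \int[leb]_x (h x * phi x)].

(* D^j g x is the tensor of all j-th order partial derivatives of g at x,     *)
(* indexed by the j-tuples of directions.                                     *)
Definition tensor (j : nat) := {ffun j.-tuple 'I_d -> R}.

Definition tensor_norm j (A : tensor j) : R := Num.sqrt (\sum_w A w ^+ 2).

Definition weak_differential j g (G : Rd -> tensor j) :=
  forall w : j.-tuple 'I_d, weak_derivative w g (fun x => G x w).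

Definition slobodeckij_seminorm r p j (G : Rd -> tensor j) : \bar R :=
  ((\int[leb \x leb]_z (tensor_norm (G z.1 - G z.2) `^ p /
      enorm (z.1 - z.2) `^ (r * p + d%:R))%:E) `^ p^-1)%E.

(* The norm of g in the homogeneous space of order s, with s = j + r and      *)
(* 0 <= r < 1, for 0 <= s.  The infimum is over the representatives of D^j g: *)
(* they agree almost everywhere and give the same value, and if D^j g is not  *)
(* a locally integrable function there is none and the norm is +oo.           *)
Definition sobolev_norm s p g : \bar R :=
  let j := Num.truncn s in
  let r := s - j%:R in
  ereal_inf [set N | exists2 G : Rd -> tensor j, weak_differential g G &
    N = if r == 0 then Lnorm leb p%:E (fun x => (tensor_norm (G x))%:E)
        else slobodeckij_seminorm r p G].

Definition sobolev s p : set (Rd -> R) :=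
  [set g | locally_integrable_rV g /\ (sobolev_norm s p g < +oo)%E].

(* Bochner space L^p(0, T; W) with W = sobolev s p *)

Definition sobolev_simple s p (h : R -> Rd -> R) :=
  exists (n : nat) (A : 'I_n -> set R) (c : 'I_n -> Rd -> R),
    [/\ forall i, measurable (A i), forall i, sobolev s p (c i) &
      h = fun t x => \sum_(i < n) \1_(A i) t * c i x].

Definition sobolev_strongly_measurable T s p (u : R -> Rd -> R) :=
  exists2 h : nat -> R -> Rd -> R, (forall n, sobolev_simple s p (h n)) &
    {ae lebesgue_measure, forall t : R, t \in `]0, T[ ->
      sobolev_norm s p (fun x => h n t x - u t x) @[n --> \oo] --> 0%E}.

Definition Lp_sobolev T s p (u : R -> Rd -> R) :=
  [/\ {ae lebesgue_measure, forall t : R, t \in `]0, T[ ->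
        sobolev s p (u t)},
      sobolev_strongly_measurable T s p u &
      (\int[lebesgue_measure]_(t in `]0%R, T[) sobolev_norm s p (u t) `^ p
        < +oo)%E].

End sobolev_slobodeckij.

(* u^[mu] *)
Definition signed_pow {R : realType} (mu u : R) : R := `|u| `^ (mu - 1) * u.

Section barenblatt.
Context {R : realType} (d : nat) (m C : R).

Definition BB_alpha : R := d%:R / (d%:R * (m - 1) + 2).

Definition BB_k : R := BB_alpha * (m - 1) / (2 * m * d%:R).

Definition BB_beta : R := BB_alpha / d%:R.

Definition barenblatt (t : R) (x : 'rV[R]_d) : R :=
  t `^ (- BB_alpha) *
  (Num.max (C - BB_k * enorm (t `^ (- BB_beta) *: x) ^+ 2) 0) `^ (m - 1)^-1.

End barenblatt.

(* Main.v *)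
Require Import Defs.
From mathcomp Require Import all_boot all_order all_algebra.
From mathcomp Require Import all_classical all_reals all_analysis.
From mathcomp Require Import measurable_realfun ring lra.
Import Order.TTheory GRing.Theory Num.Theory.
Import numFieldNormedType.Exports.
Local Open Scope classical_set_scope.
Local Open Scope ring_scope.
Set Implicit Arguments.
Unset Strict Implicit.
Unset Printing Implicit Defensive.

(** With p = m / mu and lam = t^beta, the function u = u_BB(t)^[mu] is of size
    t^(-alpha mu) on a cube of side ~ lam and vanishes off a larger one, so
    scaling suggests ||u||^p >= c t^(-alpha m + beta (d - s p)) with c > 0.
    If s >= 2 / p the exponent is at most -1, and the time integral diverges
    at t = 0.

    The lower bound is proved at every t by duality, for an arbitrary
    representative G of D^j u, s = j + r.  Pairing u with d_1^j phi, where
    d_1^j phi is bounded below on the support of u, bounds the L^1 norm of one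
    component g of G on a cube from below, hence its L^p norm by Young's
    inequality.  If r > 0, take psi >= 0 supported away from u: then
    int g psi = 0, so g(x) int psi = int (g(x) - g(y)) psi(y) dy bounds the
    double integral of |g(x) - g(y)| below in the same way. *)

(** * Smooth cutoffs on the line *)

Section smooth_towers.
Context {R : realType}.
Implicit Types (f g : R -> R) (x y a : R) (P : {poly R}) (b : nat -> R -> R).

(** A smooth function is carried together with all its derivatives, [b n] being the n-th one. Affine
    substitutions and products in separate variables then have explicit derivatives of every
    order. *)
Definition derivative_tower b :=
  forall n x, is_derive x 1 (b n) (b n.+1 x).

Definition supported_in (lo hi : R) b :=
  forall n x, b n x != 0 -> lo <= x <= hi.

Lemma tower_continuous b n : derivative_tower b -> continuous (b n).
Proof.
move=> tb x; apply: differentiable_continuous.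
by apply/derivable1_diffP; case: (tb n x).
Qed.

Lemma tower_bounded b lo hi n : derivative_tower b -> supported_in lo hi b ->
  exists2 M, 0 <= M & forall x, `|b n x| <= M.
Proof.
move=> tb sb; have [lohi|hilo] := leP lo hi; last first.
  exists 0 => // x; have [->|/sb/andP[lx xh]] := eqVneq (b n x) 0.
    by rewrite normr0.
  by have := lt_le_trans hilo (le_trans lx xh); rewrite ltxx.
have cf : {within `[lo, hi], continuous (fun x => `|b n x|)}.
  apply: continuous_subspaceT => x; apply: cvg_norm.
  exact: tower_continuous.
have [c _ cmax] := EVT_max lohi cf.
exists `|b n c| => // x; have [->|/sb xin] := eqVneq (b n x) 0.
  by rewrite normr0.
by apply: cmax; rewrite in_itv /= xin.
Qed.

Lemma exprn_le_expR n y : 0 <= y -> y ^+ n <= n`!%:R * expR y.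
Proof.
move=> y0; case: n => [|n].
  by rewrite expr0 fact0 mul1r (le_trans _ (expR_ge1Dx y))// lerDl.
rewrite mulrC -ler_pdivrMr ?ltr0n ?fact_gt0//.
by rewrite (le_trans _ (expR_ge1Dxn n y0))// lerDr.
Qed.

Lemma poly_expRN_bounded P :
  exists C, forall y, 0 <= y -> `|P.[y] * expR (- y)| <= C.
Proof.
exists (\sum_(i < size P) `|P`_i| * i`!%:R) => y y0.
rewrite normrM (ger0_norm (expR_ge0 _)) expRN ler_pdivrMr ?expR_gt0//.
rewrite horner_coef (le_trans (ler_norm_sum _ _ _))// mulr_suml ler_sum// => i _.
rewrite normrM -mulrA ler_wpM2l// normrX ger0_norm//; exact: exprn_le_expR.
Qed.

(* the derivative of P(1/x) exp(-1/x) is (X^2 (P - P'))(1/x) exp(-1/x) *)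
Fixpoint flat_poly n : {poly R} :=
  if n is k.+1 then 'X^2 * (flat_poly k - (flat_poly k)^`()) else 1.

Definition flat n x : R :=
  if 0 < x then (flat_poly n).[x^-1] * expR (- x^-1) else 0.

(** For x > 0 and y = 1/x, dividing [flat n x] by x^2 gives again a polynomial in y times exp(-y),
    which is bounded. The quadratic decay is what differentiability at 0 rests on. *)
Lemma flat_le_sqr n : exists2 C, 0 <= C & forall x, `|flat n x| <= C * x ^+ 2.
Proof.
have [C HC] := poly_expRN_bounded ('X^2 * flat_poly n).
have C0 : 0 <= C by apply: le_trans (HC 0 _).
exists C => // x; rewrite /flat; case: ifPn => x0; last first.
  by rewrite normr0 mulr_ge0 ?sqr_ge0.
have xi : 0 <= x^-1 by rewrite invr_ge0 ltW.
have := HC _ xi.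
rewrite hornerM hornerXn -mulrA normrM ger0_norm ?sqr_ge0//.
by rewrite exprVn mulrC ler_pdivrMr ?exprn_gt0.
Qed.

Lemma is_derive_flat : derivative_tower flat.
Proof.
move=> n x; have [x0|x0|->] := ltgtP x 0.
- rewrite {2}/flat ltNge (ltW x0)/=.
  apply: (@near_eq_is_derive _ _ _ (cst 0)) => //.
  have : \forall z \near x, z < 0 by exact: lt_nbhsl.
  by apply: filterS => z z0; rewrite /flat ltNge (ltW z0).
- have eqf : \forall z \near x, (flat_poly n).[z^-1] * expR (- z^-1) = flat n z.
    have : \forall z \near x, 0 < z by exact: lt_nbhsr.
    by apply: filterS => z z0; rewrite /flat z0.
  apply: (near_eq_is_derive eqf).
  have dV : is_derive x 1 (fun z : R => z^-1) (- x ^- 2).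
    have := @is_deriveV _ id x 1 1 (lt0r_neq0 x0) (is_derive_id _ _).
    by rewrite /= [_ *: _]mulr1.
  have dP := is_derive1_comp (is_derive_poly (flat_poly n) x^-1) dV.
  have dE : is_derive x 1 (fun z : R => expR (- z^-1)) (expR (- x^-1) * x ^- 2).
    have dN : is_derive x 1 (fun z : R => - z^-1) (x ^- 2).
      by rewrite -[x ^- 2]opprK; exact: (is_deriveN dV).
    exact (@is_derive1_comp _ expR (fun z : R => - z^-1) x _ _ (is_derive_expR _) dN).
  have -> : flat n.+1 x = (flat_poly n).[x^-1] *: (expR (- x^-1) * x ^- 2) +
      expR (- x^-1) *: ((flat_poly n)^`().[x^-1] * - x ^- 2); last first.
    exact (is_deriveM dP dE).
  rewrite /flat x0 /= hornerM hornerXn hornerD hornerN -!exprVn.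
  rewrite -![_ *: _]/(_ * _). ring.
- have [C C0 HC] := flat_le_sqr n.
  have -> : flat n.+1 0 = 0 by rewrite /flat ltxx.
  (* At the junction 0, Caratheodory's criterion is applied to the slope [flat n z / z]. Its value
     at 0 is 0 because the inverse of 0 is 0, and it is O(|z|) by the quadratic bound. *)
  apply/is_derive1_caratheodory; exists (fun z => flat n z / z); split.
  + move=> z; rewrite /flat ltxx !subr0 -/(flat n z).
    have [->|z0] := eqVneq z 0; first by rewrite mulr0 /flat ltxx.
    by rewrite mulfVK.
  + suff H : flat n z / z @[z --> (0:R)] --> (0:R) by rewrite /prop_for /continuous_at invr0 mulr0.
    apply/cvgr0Pnorm_le => e e0.
    near=> z.
    have [->|z0] := eqVneq z 0; first by rewrite invr0 mulr0 normr0 ltW.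
    rewrite normrM normfV ler_pdivrMr ?normr_gt0// (le_trans (HC z))//.
    rewrite -real_normK ?num_real// expr2 mulrA ler_wpM2r//.
    have : `|z| <= e / (C + 1).
      near: z; apply: cvgr0_norm_le; first exact: cvg_id.
      by rewrite divr_gt0// ltr_wpDl.
    move=> ze; rewrite (le_trans (ler_wpM2l C0 ze))//.
    by rewrite mulrCA ger_pMr// ler_pdivrMr ?mul1r ?ltr_wpDl// lerDl.
  + by rewrite invr0 mulr0.
Unshelve. all: by end_near. Qed.

(* spans the derivatives of exp(-1/x) exp(-1/(1-x)) *)
Inductive flat_span : (R -> R) -> Prop :=
| flat_span_prod i j : flat_span (fun x => flat i x * flat j (1 - x))
| flat_span_sub f g : flat_span f -> flat_span g -> flat_span (f - g).

Lemma flat_span_derive f : flat_span f ->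
  exists2 df, flat_span df & forall x, is_derive x 1 f (df x).
Proof.
elim=> [i j|{}f g _ [df sf df'] _ [dg sg dg']]; last first.
  by exists (df - dg) => [|x]; [exact: flat_span_sub|exact: is_deriveB].
exists ((fun x => flat i.+1 x * flat j (1 - x)) -
        (fun x => flat i x * flat j.+1 (1 - x))) => [|x].
  by apply: flat_span_sub; exact: flat_span_prod.
have dB : is_derive x 1 (fun z : R => 1 - z) (-1).
  by rewrite -[-1]add0r; exact: (is_deriveB (is_derive_cst _ _ _) (is_derive_id _ _)).
have dj := @is_derive1_comp _ (flat j) (fun z : R => 1 - z) x _ _
  (is_derive_flat _ _) dB.
have -> : ((fun x => flat i.+1 x * flat j (1 - x)) -
        (fun x => flat i x * flat j.+1 (1 - x))) x =
   flat i x *: (flat j.+1 (1 - x) * -1) + flat j (1 - x) *: flat i.+1 x.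
  by rewrite !fctE -![_ *: _]/(_ * _); ring.
exact (is_deriveM (is_derive_flat i x) dj).
Qed.

Lemma flat_span_support f x : flat_span f -> f x != 0 -> 0 <= x <= 1.
Proof.
move=> sf; apply: contraNT => x01; apply/eqP.
elim: sf => [i j|{}f g _ fx _ gx]; last by rewrite !fctE fx gx subr0.
rewrite /flat; case: ltP => x0; last by rewrite mul0r.
case: ltP => x1; last by rewrite mulr0.
by move: x01; rewrite (ltW x0) -subr_ge0 (ltW x1).
Qed.

Lemma bump_tower : exists b, [/\ derivative_tower b, supported_in 0 1 b,
  forall x, 0 <= b 0 x & 0 < b 0 2^-1].
Proof.
(* [D] selects a derivative on the span; off the span nothing is asked of it, and f itself serves as
   a value. *)
have [D HD] : {D : (R -> R) -> R -> R & forall f, flat_span f ->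
    flat_span (D f) /\ forall x, is_derive x 1 f (D f x)}.
  apply: (@choice _ _ (fun f g => flat_span f ->
    flat_span g /\ forall x, is_derive x 1 f (g x))) => f.
  have [/flat_span_derive[g sg dg]|nf] := pselect (flat_span f).
    by exists g.
  by exists f.
pose b n := iter n D (fun x => flat 0 x * flat 0 (1 - x)).
have sb n : flat_span (b n).
  by elim: n => [|n IH]; [exact: flat_span_prod|exact: (HD _ IH).1].
have flat0_ge0 x : 0 <= flat 0 x.
  by rewrite /flat; case: ifP => // _; rewrite hornerC mul1r expR_ge0.
exists b; split.
- by move=> n x; exact: (HD _ (sb n)).2.
- by move=> n x; exact: flat_span_support.
- by move=> x; rewrite /b/= mulr_ge0.
- rewrite /b/= /flat !ifT ?hornerC ?mul1r ?mulr_gt0 ?expR_gt0//; lra.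
Qed.

(** If [b n.+1] vanished identically, [b n] would be constant, hence equal to its value 0 at
    [hi + 1]. *)
Lemma tower_nonzero b lo hi n : derivative_tower b -> supported_in lo hi b ->
  (exists x, b 0 x != 0) -> exists x, b n x != 0.
Proof.
move=> tb sb b0; elim: n => [//|n [a bna]].
apply: contrapT => H; move: bna; apply/negP; rewrite negbK.
have db x : is_derive x 1 (b n) 0.
  have -> : 0 = b n.+1 x; last exact: tb.
  by apply/esym/eqP/negP => /negP Hx; apply: H; exists x.
rewrite (is_derive_0_is_cst a (hi + 1) db).
by apply/negP => /negP /sb /andP[_]; rewrite gerDl ler10.
Qed.

Lemma tower_affine b s k a : derivative_tower b ->
  derivative_tower (fun n x => s * k ^+ n * b n (a + k * x)).
Proof.
move=> tb n x.
have dA : is_derive x 1 (fun z : R => a + k * z) k.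
  rewrite -[X in is_derive _ _ _ X]add0r -{2}[k]mulr1.
  exact (is_deriveD (is_derive_cst a x 1) (is_deriveZ k (is_derive_id x 1))).
have dk := @is_derive1_comp _ (b n) (fun z : R => a + k * z) x _ _ (tb _ _) dA.
have -> : s * k ^+ n.+1 * b n.+1 (a + k * x) = (s * k ^+ n) *: (b n.+1 (a + k * x) * k).
  by rewrite -[_ *: _]/(_ * _) exprS; ring.
exact (is_deriveZ (s * k ^+ n) dk).
Qed.

(** The bump is magnified around a point [a] where its j-th derivative is nonzero, until that
    derivative stays bounded away from 0 on the whole image of |x| <= rho lam. The chain rule
    produces the factor lam^-j. *)
Lemma cutoff_tower j (rho : R) : 0 < rho -> exists c M B : R,
  [/\ 0 < c, 0 < M, 0 < B & forall lam : R, 0 < lam -> exists b,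
    [/\ derivative_tower b, supported_in (- (B * lam)) (B * lam) b,
      forall x, `|x| <= rho * lam -> c * lam ^- j <= b j x,
      forall x, `|b 0 x| <= M & j = 0 -> forall x, 0 <= b 0 x]].
Proof.
move=> rho0; have [b [tb sb b_ge0 b_gt0]] := bump_tower.
have [M M0 HM] := tower_bounded 0 tb sb.
(* The sign [sg] makes the j-th derivative positive at [a]. For j = 0 the choice a = 1/2, sg = 1
   keeps the function nonnegative. *)
have [a [sg [sg1 sga sg_ge0]]] : exists a sg, [/\ `|sg| = 1, 0 < sg * b j a &
    j = 0%N -> 0 <= sg :> R].
  have [->|j0] := eqVneq j 0.
    by exists 2^-1, 1; split; rewrite ?normr1 ?mul1r.
  have [|a ba] := tower_nonzero j tb sb; first by exists 2^-1; rewrite gt_eqF.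
  exists a, (Num.sg (b j a)); split; first by rewrite normr_sg ba.
    by rewrite -normrEsg normr_gt0.
  by move/eqP; rewrite (negPf j0).
set c := sg * b j a in sga.
have [d d0 Hd] : exists2 d : R, 0 < d & forall y, `|y - a| <= d -> c / 2 <= sg * b j y.
  have cb : sg * b j y @[y --> a] --> c.
    by apply: cvgMl_tmp; exact: (tower_continuous tb).
  have : \forall y \near a, c / 2 <= sg * b j y.
    by apply: (cvgr_ge _ cb); lra.
  move=> /nbhs_ballP[e /= e0 He]; exists (e / 2); first by rewrite divr_gt0.
  move=> y ya; apply: He; rewrite /ball /= distrC (le_lt_trans ya)//; lra.
(* The substitution will be a + k x with k = d / (rho lam). It sends |x| <= rho lam into the
   d-neighbourhood of [a], and a + k x in [0, 1] forces |x| <= (1 + |a|) / k, whence the support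
   radius. *)
exists (c / 2 * (d / rho) ^+ j), (M + 1), ((1 + `|a|) * (rho / d)); split.
- by rewrite mulr_gt0// ?exprn_gt0 ?divr_gt0.
- by rewrite ltr_wpDl.
- by rewrite mulr_gt0// ?divr_gt0// ltr_wpDr.
move=> lam lam0; pose k := d / (rho * lam).
have k0 : 0 < k by rewrite divr_gt0// mulr_gt0.
have kE : rho / d * lam = k^-1 by rewrite /k invf_div mulrAC.
exists (fun n x => sg * k ^+ n * b n (a + k * x)); split.
- exact: tower_affine.
- move=> n x; rewrite !mulf_eq0 !negb_or => /andP[_ /sb /andP[lo hi]].
  rewrite -ler_norml -mulrA kE ler_pdivlMr//.
  have : `|k * x| <= 1 + `|a|.
    rewrite ler_norml; have := ler_norm a; have := ler_norm (- a).
    by rewrite normrN => *; apply/andP; split; lra.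
  by rewrite normrM (gtr0_norm k0) mulrC.
- move=> x xr.
  have -> : c / 2 * (d / rho) ^+ j * lam ^- j = k ^+ j * (c / 2).
    have -> : k = d / rho / lam by rewrite /k invfM mulrA.
    by rewrite -exprVn -[LHS]mulrA -exprMn mulrC.
  rewrite [sg * _]mulrC -[leRHS]mulrA ler_wpM2l ?exprn_ge0 ?(ltW k0)//.
  apply: Hd; rewrite addrAC subrr add0r normrM gtr0_norm//.
  rewrite (le_trans (ler_wpM2l (ltW k0) xr))//.
  by rewrite /k mulfVK// mulf_neq0// gt_eqF.
- move=> x; rewrite expr0 mulr1 normrM sg1 mul1r (le_trans (HM _))// lerDl//.
- by move=> j0 x; rewrite expr0 mulr1 mulr_ge0// sg_ge0.
Qed.

End smooth_towers.

(** * Closed cubes and their Lebesgue measure *)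

Section cubes.
Context {R : realType}.

Definition cube d (lo hi : R) : set 'rV[R]_d :=
  [set x | forall i, x ord0 i \in `[lo, hi]].

Lemma cubeP d lo hi (x : 'rV[R]_d) :
  cube lo hi x <-> (forall i, lo <= x ord0 i <= hi).
Proof. by split => H i; have := H i; rewrite in_itv. Qed.

Lemma compact_cube d lo hi : compact (@cube d lo hi).
Proof.
exact: (@rV_compact _ _ (fun=> `[lo, hi]%classic) (fun=> @segment_compact R lo hi)).
Qed.

Lemma measurable_cube d lo hi : measurable (@cube d lo hi).
Proof.
have -> : @cube d lo hi = \bigcap_(i in [set: 'I_d]) (@rV_coord _ R d i @^-1` `[lo, hi]).
  by apply/seteqP; split => x H i; [move=> _; exact: H|exact: H].
apply: fin_bigcap_measurable => // i _.
by rewrite -[X in measurable X]setTI; exact: measurable_rV_coord.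
Qed.

(** Induction along the recursive construction of [lebesgue_rV]: under [rV_cons] a cube is an
    interval times a cube of one dimension less. *)
Lemma lebesgue_cube d lo hi : lo <= hi ->
  lebesgue_rV R d (cube lo hi) = ((hi - lo) ^+ d)%:E.
Proof.
move=> lohi; elim: d => [|d IH].
  by rewrite /= diracE expr0 mem_set// => -[].
have -> : lebesgue_rV R d.+1 (cube lo hi) = (@lebesgue_measure R \x lebesgue_rV R d)%E
    (@rV_cons R d @^-1` cube lo hi) by [].
rewrite (_ : _ @^-1` _ = `[lo, hi]%classic `*` @cube d lo hi); last first.
  apply/seteqP; split => [[a v]|[a v]] /=.
    move=> H; split; first by have := H ord0; rewrite mxE unlift_none.
    by move=> i; have := H (lift ord0 i); rewrite mxE liftK.
  by move=> [/= aI vC] i; rewrite mxE; case: unliftP => [j _|_] //=; exact: vC.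
rewrite product_measure1E//; last exact: measurable_cube.
rewrite exprS EFinM -IH; congr (_ * _)%E.
have /= -> := @lebesgue_measure_itv R `[lo, hi]%R.
by rewrite lte_fin; case: ltgtP lohi => // ->; rewrite subrr.
Qed.

End cubes.

(** * Products of one-variable functions and their partial derivatives *)

Section product_functions.
Context {R : realType} {d : nat}.
Implicit Types (b : 'I_d -> nat -> R -> R) (w : seq 'I_d) (x : 'rV[R]_d).

(** The word [w] lists directions of differentiation, so the number of occurrences of i in it is the
    order in the i-th variable. All iterated partials of a product of towers thus have one form. *)
Definition tower_prod b w x : R := \prod_i b i (count_mem i w) (x ord0 i).

Lemma is_derive_line (f : 'rV[R]_d -> R) (x v : 'rV[R]_d) (df : R) :
  is_derive (0 : R) 1 (fun h : R => f (h *: v + x)) df -> is_derive x v f df.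
Proof.
have E : (fun h : R => h^-1 *: ((f \o shift x) (h *: v) - f x)) =
   (fun h => h^-1 *: (((fun h => f (h *: v + x)) \o shift 0) (h *: (1 : R)) - f (0 *: v + x))).
  apply/funext => h /=; rewrite scale0r add0r.
  by rewrite [h *: (1 : R)]mulr1 addr0.
case=> H1 H2; split; first by rewrite /derivable E.
by rewrite -H2 /derive E.
Qed.

Lemma is_derive_tower_prod b w x i : (forall k, derivative_tower (b k)) ->
  is_derive x (delta_mx ord0 i) (tower_prod b w) (tower_prod b (i :: w) x).
Proof.
move=> tb; apply: is_derive_line.
pose K := \prod_(k | k != i) b k (count_mem k w) (x ord0 k).
have -> : (fun h : R => tower_prod b w (h *: delta_mx ord0 i + x)) =
    (fun h => K * b i (count_mem i w) (x ord0 i + 1 * h)).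
  apply/funext => h; rewrite /tower_prod (bigD1 i)//= mulrC; congr (_ * _).
    apply: eq_bigr => k ki; rewrite !mxE (negPf ki) andbF mulr0 add0r//.
  by rewrite !mxE !eqxx mulr1 addrC mul1r.
have -> : tower_prod b (i :: w) x =
   K * 1 ^+ 1 * b i (count_mem i w).+1 (x ord0 i + 1 * 0).
  rewrite /tower_prod (bigD1 i)//= eqxx mulrC mulr0 addr0 expr1 mulr1; congr (_ * _).
  by apply: eq_bigr => k ki; rewrite eq_sym (negPf ki).
have := @tower_affine R (fun n => b i (n + count_mem i w)%N) K 1 (x ord0 i).
move=> /(_ (fun n => tb i (n + count_mem i w)%N)) /(_ 0 0).
rewrite /= expr0 mulr1; exact.
Qed.

Lemma iter_partial_tower_prod b w : (forall k, derivative_tower (b k)) ->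
  iter_partial w (tower_prod b [::]) = tower_prod b w.
Proof.
move=> tb; elim: w => //= i w ->; apply/funext => x.
by rewrite /partial; case: (is_derive_tower_prod w x i tb).
Qed.

Lemma continuous_tower_prod b w : (forall k, derivative_tower (b k)) ->
  continuous (tower_prod b w).
Proof.
move=> tb; rewrite /tower_prod; elim: (index_enum _) => [|i s IH] x.
  have -> : (fun x : 'rV[R]_d => \prod_(k <- [::]) b k (count_mem k w) (x ord0 k)) =
    cst 1 by apply/funext => y; rewrite big_nil.
  exact: cst_continuous.
have -> : (fun x : 'rV[R]_d => \prod_(k <- i :: s) b k (count_mem k w) (x ord0 k)) =
   (fun x => b i (count_mem i w) (x ord0 i) *
     \prod_(k <- s) b k (count_mem k w) (x ord0 k)).
  by apply/funext => y; rewrite big_cons.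
apply: (@cvgM _ _ _ (nbhs_filter x)); last exact: IH.
apply: (@continuous_comp _ _ _ (fun y : 'rV[R]_d => y ord0 i) (b i (count_mem i w)) x).
  exact: coord_continuous.
exact: (tower_continuous (tb i)).
Qed.

Lemma measurable_tower_prod b w : (forall k, derivative_tower (b k)) ->
  measurable_fun setT (tower_prod b w).
Proof.
move=> tb; apply: measurable_prod => i _.
apply: (measurableT_comp _ (measurable_rV_coord i)).
apply: continuous_measurable_fun; exact: (tower_continuous (tb i)).
Qed.

Lemma tower_prod_cube b w x lo hi : (forall k, supported_in lo hi (b k)) ->
  tower_prod b w x != 0 -> cube lo hi x.
Proof.
move=> sb /prodf_neq0 H; apply/cubeP => i; exact: sb (H i isT).
Qed.

Lemma test_function_tower_prod b lo hi : (forall k, derivative_tower (b k)) ->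
  (forall k, supported_in lo hi (b k)) -> test_function (tower_prod b [::]).
Proof.
move=> tb sb; split.
  move=> w; rewrite iter_partial_tower_prod//; split.
    exact: continuous_tower_prod.
  by move=> x i; case: (is_derive_tower_prod w x i tb).
apply: (subclosed_compact _ (@compact_cube R d lo hi)); first exact: closed_closure.
rewrite closureE; apply: smallest_sub.
  by apply: compact_closed; [exact: norm_hausdorff|exact: compact_cube].
by move=> x /=; exact: tower_prod_cube.
Qed.

Lemma tower_prod_bounded b w lo hi : (forall k, derivative_tower (b k)) ->
  (forall k, supported_in lo hi (b k)) ->
  exists M, forall x, `|tower_prod b w x| <= M.
Proof.
move=> tb sb.
have H i : exists M, forall y : R, `|b i (count_mem i w) y| <= M.
  by have [M _ HM] := tower_bounded (count_mem i w) (tb i) (sb i); exists M.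
have [M HM] := choice H.
exists (\prod_i M i) => x; rewrite normr_prod; apply: ler_prod => i _.
by rewrite normr_ge0 HM.
Qed.

End product_functions.

(** * Cutoff functions in several variables *)

Section cutoff_functions.
Context {R : realType}.

(** Measurability, boundedness and support are recorded for every iterated partial, so that its
    pairings with locally integrable functions are integrable. *)
Definition localized d (lo hi : R) (phi : 'rV[R]_d -> R) :=
  test_function phi /\ forall w, [/\ measurable_fun setT (iter_partial w phi),
    exists M, forall x, `|iter_partial w phi x| <= M &
    forall x, iter_partial w phi x != 0 -> cube lo hi x].

Lemma localized_tower_prod d (b : 'I_d -> nat -> R -> R) lo hi :
  (forall k, derivative_tower (b k)) -> (forall k, supported_in lo hi (b k)) ->
  localized lo hi (tower_prod b [::]).
Proof.
move=> tb sb; split; first exact: test_function_tower_prod sb.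
move=> w; rewrite iter_partial_tower_prod//; split.
- exact: measurable_tower_prod.
- exact: tower_prod_bounded sb.
- by move=> x; exact: tower_prod_cube.
Qed.

(** The first variable carries a tower whose j-th derivative is bounded below, the others one that
    is bounded below itself; differentiation in direction [ord0] touches only the first factor. *)
Lemma cutoff_function n j (rho : R) : 0 < rho -> exists c M B : R,
  [/\ 0 < c, 0 < M, 0 < B & forall lam : R, 0 < lam ->
    exists phi : 'rV[R]_n.+1 -> R,
    [/\ localized (- (B * lam)) (B * lam) phi,
      forall x, cube (- (rho * lam)) (rho * lam) x ->
        c * lam ^- j <= iter_partial (nseq j ord0) phi x &
      forall x, `|phi x| <= M]].
Proof.
move=> rho0.
have [c1 [M1 [B1 [c1_gt0 M1_gt0 B1_gt0 H1]]]] := cutoff_tower j rho0.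
have [c0 [M0 [B0 [c0_gt0 M0_gt0 B0_gt0 H0]]]] := cutoff_tower 0 rho0.
exists (c1 * c0 ^+ n), (M1 * M0 ^+ n), (B1 + B0).
split; rewrite ?mulr_gt0 ?exprn_gt0 ?addr_gt0//.
move=> lam lam0.
have [b1 [tb1 sb1 lb1 ub1 _]] := H1 _ lam0.
have [b0 [tb0 sb0 lb0 ub0 _]] := H0 _ lam0.
pose b (k : 'I_n.+1) := if k == ord0 then b1 else b0.
have tb k : derivative_tower (b k) by rewrite /b; case: ifP.
have sb k : supported_in (- ((B1 + B0) * lam)) ((B1 + B0) * lam) (b k).
  have ? : 0 < B1 * lam by rewrite mulr_gt0.
  have ? : 0 < B0 * lam by rewrite mulr_gt0.
  move=> m x; rewrite /b; case: ifP => _ => [/sb1|/sb0] => /andP[? ?];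
    apply/andP; split; lra.
have b0E : b ord0 = b1 by rewrite /b eqxx.
have bSE (k : 'I_n) : b (lift ord0 k) = b0 by [].
exists (tower_prod b [::]); split.
- exact: localized_tower_prod.
- move=> x /cubeP xc; rewrite iter_partial_tower_prod// /tower_prod big_ord_recl.
  rewrite b0E count_nseq /= ?eqxx ?mul1n mulrAC.
  rewrite ler_pM ?mulr_ge0 ?invr_ge0 ?exprn_ge0 ?(ltW lam0) ?(ltW c1_gt0) ?(ltW c0_gt0)//.
    by apply: lb1; rewrite ler_norml; exact: xc.
  rewrite -[in leLHS](card_ord n) -prodr_const ler_prod// => k _.
  rewrite (ltW c0_gt0) bSE count_nseq /= mul0n.
  have := lb0 (x ord0 (lift ord0 k)); rewrite expr0 invr1 mulr1 ler_norml; apply.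
  exact: xc.
- move=> x; rewrite /tower_prod big_ord_recl normrM b0E ler_pM ?normr_ge0//.
  by rewrite normr_prod -[in leRHS](card_ord n) -prodr_const ler_prod// => k _; rewrite normr_ge0 bSE ub0.
Qed.

(** A product of nonnegative one-variable cutoffs is translated along the diagonal, so far that
    every coordinate exceeds rho lam on its support. *)
Lemma distant_cutoff_function n (rho : R) : 0 < rho -> exists c M a l h B : R,
  [/\ [/\ 0 < c, 0 < M, rho < a <= l & l < h <= B] & forall lam : R, 0 < lam ->
    exists psi : 'rV[R]_n.+1 -> R,
    [/\ localized (a * lam) (B * lam) psi,
      forall x, 0 <= psi x <= M &
      forall x, cube (l * lam) (h * lam) x -> c <= psi x]].
Proof.
move=> rho0.
have [c [M [B [c0 M0 B0 H]]]] := cutoff_tower 0 (@ltr01 R).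
(* The plateau has centre (rho + B + 1) lam and half-width min(1, B) lam: at most lam, where the
   cutoff is bounded below, and at most B lam, so that [l] and [h] respect the support bounds. *)
exists (c ^+ n.+1), (M ^+ n.+1), (rho + 1), (rho + B + 1 - Num.min 1 B),
  (rho + B + 1 + Num.min 1 B), (rho + 2 * B + 1).
have [m1 mB m0] : [/\ Num.min 1 B <= 1, Num.min 1 B <= B & 0 < Num.min 1 B].
  by rewrite !ge_min !lexx orbT lt_min ltr01.
split; first by split; rewrite ?exprn_gt0//; apply/andP; split; lra.
move=> lam lam0; have [b [tb sb lb ub b_ge0]] := H _ lam0.
pose e := (rho + B + 1) * lam.
pose b' (n : nat) (x : R) := 1 * 1 ^+ n * b n (- e + 1 * x).
have b'E m x : b' m x = b m (x - e) by rewrite /b' expr1n !mul1r addrC.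
have tb' : derivative_tower b' by exact: tower_affine.
have sb' : supported_in ((rho + 1) * lam) ((rho + 2 * B + 1) * lam) b'.
  by move=> m x; rewrite b'E /e => /sb/andP[? ?]; apply/andP; split; lra.
exists (tower_prod (fun _ : 'I_n.+1 => b') [::]); split.
- exact: localized_tower_prod.
- move=> x; apply/andP; split.
    by apply: prodr_ge0 => i _; rewrite b'E; exact: b_ge0.
  rewrite -[in leRHS](card_ord n.+1) -prodr_const ler_prod// => k _.
  by rewrite b'E b_ge0//= (le_trans (ler_norm _)).
- move=> x /cubeP xc.
  rewrite -[in leLHS](card_ord n.+1) -prodr_const ler_prod// => k _.
  rewrite (ltW c0)/= b'E.
  have := lb (x ord0 k - e); rewrite expr0 invr1 mulr1 mul1r ler_norml; apply.
  have := xc k; have : Num.min 1 B * lam <= lam by rewrite ger_pMl.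
  rewrite /e => ? /andP[? ?]; apply/andP; split; lra.
Qed.

End cutoff_functions.

(** * Integral inequalities *)

Section integral_bounds.
Context {disp : measure_display} {T : measurableType disp} {R : realType}.
Variable mu : {measure set T -> \bar R}.
Implicit Types (D E Q : set T) (f g phi : T -> R) (M a p V : R).

(* The integral of a nonnegative function is a supremum over simple functions,
   so monotonicity needs no measurability. *)
Lemma ge0_le_integral_subset D E (f g : T -> \bar R) :
  (forall x, D x -> 0 <= f x)%E -> (forall x, E x -> 0 <= g x)%E ->
  (forall x, D x -> E x /\ (f x <= g x)%E) ->
  (\int[mu]_(x in D) f x <= \int[mu]_(x in E) g x)%E.
Proof.
move=> f0 g0 fg; rewrite !ge0_integralE//; apply: le_ereal_sup.
move=> _ [h /= hf <-]; exists h => //= x; apply: le_trans (hf x) _.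
rewrite !patchE; case: ifPn => [/set_mem Dx|_]; last first.
  by case: ifPn => // /set_mem; exact: g0.
by have [/mem_set -> ] := fg _ Dx.
Qed.

(** A weak form of Jensen's inequality, obtained by integrating a^(p-1) f <= a^p + f^p. The factor 2
    in the assumption pays for the term a^p V, which is finite and cancels. *)
Lemma power_mean D f p a V : measurable D -> measurable_fun D f ->
  (forall x, D x -> 0 <= f x) -> 1 <= p -> 0 <= a -> mu D = V%:E ->
  ((2 * a * V)%:E <= \int[mu]_(x in D) (f x)%:E)%E ->
  ((a `^ p * V)%:E <= \int[mu]_(x in D) (f x `^ p)%:E)%E.
Proof.
move=> mD mf f0 p1 a0 DV aV.
have p0 : 0 < p by rewrite (lt_le_trans _ p1).
have V0 : 0 <= V by rewrite -lee_fin -DV.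
have mfp : measurable_fun D (fun x => f x `^ p).
  exact: (measurableT_comp (measurable_powR p) mf).
have young x : D x -> a `^ (p - 1) * f x <= a `^ p + f x `^ p.
  move=> Dx; have [fa|af] := leP (f x) a.
    rewrite (@le_trans _ _ (a `^ p))// ?lerDl ?powR_ge0//.
    by rewrite -[leRHS]mulr_powRB1// mulrC ler_wpM2r ?powR_ge0.
  rewrite (@le_trans _ _ (f x `^ p))// ?lerDr ?powR_ge0//.
  rewrite -[leRHS]mulr_powRB1 ?f0// mulrC ler_wpM2l ?f0//.
  by rewrite ge0_ler_powR ?nnegrE ?f0 ?subr_ge0// ltW.
have : ((a `^ (p - 1))%:E * (2 * a * V)%:E <=
    (a `^ p * V)%:E + \int[mu]_(x in D) (f x `^ p)%:E)%E.
  rewrite (le_trans (lee_wpmul2l _ aV)) ?lee_fin ?powR_ge0//.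
  rewrite -ge0_integralZl ?lee_fin ?powR_ge0//; last exact/measurable_EFinP.
  rewrite EFinM -DV -integral_cst// -ge0_integralD//; last 3 first.
    by move=> x _; rewrite lee_fin powR_ge0.
    by move=> x _; rewrite lee_fin powR_ge0.
    exact/measurable_EFinP.
  apply: ge0_le_integral_subset => x Dx; rewrite -?EFinM -?EFinD ?lee_fin.
  - by rewrite mulr_ge0 ?powR_ge0 ?f0.
  - by rewrite addr_ge0 ?powR_ge0.
  - by split => //; exact: young.
have -> : ((a `^ (p - 1))%:E * (2 * a * V)%:E = (a `^ p * V)%:E + (a `^ p * V)%:E)%E.
  by rewrite -EFinM -EFinD -(mulr_powRB1 a0 p0); congr EFin; ring.
by rewrite leeD2lE.
Qed.

Lemma normr_Rintegral_le f : measurable_fun setT f ->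
  (`|\int[mu]_x f x|%:E <= \int[mu]_x `|f x|%:E)%E.
Proof.
move=> /measurable_EFinP mf.
apply: le_trans (le_abse_integral mu measurableT mf).
(* [Rintegral] reads an infinite integral as 0, and the bound is then trivial. *)
rewrite /Rintegral; case: (\int[mu]_x _)%E => [r| |] //=.
- by rewrite leey.
- by rewrite leey.
Qed.

Lemma integral_normM_le M Q g phi : 0 <= M -> measurable Q -> measurable_fun setT g ->
  (forall x, `|phi x| <= M) -> (forall x, phi x != 0 -> Q x) ->
  (\int[mu]_x `|g x * phi x|%:E <= M%:E * \int[mu]_(x in Q) `|g x|%:E)%E.
Proof.
move=> M0 mQ mg HM Qphi.
rewrite -ge0_integralZl//; last first.
  by apply/measurable_EFinP; apply: measurableT_comp => //; exact: measurable_funTS.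
rewrite (@integral_mkcond _ _ _ _ Q).
apply: ge0_le_integral_subset => [x _|x _|x _]; rewrite ?lee_fin//.
  by rewrite patchE; case: ifP => // _; rewrite -EFinM lee_fin mulr_ge0.
split=> //; rewrite patchE; case: ifPn => [_|Qx].
  by rewrite -EFinM lee_fin normrM mulrC ler_wpM2r.
have [->|/Qphi /mem_set] := eqVneq (phi x) 0; first by rewrite mulr0 normr0.
by rewrite (negPf Qx).
Qed.

Lemma integrable_localized M Q g phi : 0 <= M -> measurable Q -> measurable_fun setT g ->
  measurable_fun setT phi ->
  (forall x, `|phi x| <= M) -> (forall x, phi x != 0 -> Q x) ->
  (\int[mu]_(x in Q) `|g x|%:E < +oo)%E ->
  mu.-integrable setT (EFin \o (fun x => g x * phi x)).
Proof.
move=> M0 mQ mg mphi HM Qphi goo; apply/integrableP; split.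
  by apply/measurable_EFinP; exact: measurable_funM.
apply: le_lt_trans (integral_normM_le M0 mQ mg HM Qphi) _.
have : (0 <= \int[mu]_(x in Q) `|g x|%:E)%E by apply: integral_ge0.
by case: integral goo => // r _ _; rewrite -EFinM ltry.
Qed.

End integral_bounds.

(** * Duality with test functions *)

Section weak_derivative_bounds.
Context {R : realType} {d : nat}.
Local Notation leb := (lebesgue_rV R d).
Implicit Types (u g phi psi : 'rV[R]_d -> R) (w : seq 'I_d).

Lemma locally_integrable_cube g lo hi : locally_integrable_rV g ->
  (\int[leb]_(x in cube lo hi) `|g x|%:E < +oo)%E.
Proof. by case=> _; apply; exact: compact_cube. Qed.

Lemma localized_integrable g phi w lo hi : locally_integrable_rV g ->
  localized lo hi phi ->
  leb.-integrable setT (EFin \o (fun x => g x * iter_partial w phi x)).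
Proof.
move=> lg [_ /(_ w)[mphi [M HM] sphi]].
have M0 : 0 <= M by exact: le_trans (HM 0).
apply: (integrable_localized M0 (@measurable_cube R d lo hi) lg.1 mphi HM sphi).
exact: locally_integrable_cube.
Qed.

Lemma localized_cst_integrable (a : R) phi w lo hi :
  localized lo hi phi ->
  leb.-integrable setT (EFin \o (fun x => a * iter_partial w phi x)).
Proof.
move=> [_ /(_ w)[mphi [M HM] sphi]].
have M0 : 0 <= M by exact: le_trans (HM 0).
have mc : measurable_fun setT (fun _ : 'rV[R]_d => a) by [].
apply: (integrable_localized M0 (@measurable_cube R d lo hi) mc mphi HM sphi).
rewrite integral_cst; last exact: measurable_cube.
(* [localized] does not order [lo] and [hi]; enlarging the cube to [Num.max lo hi] gives the
   nonnegative side that [lebesgue_cube] requires. *)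
apply: (@le_lt_trans _ _ (`|a|%:E * leb (cube lo (Num.max lo hi)))%E).
  rewrite lee_wpmul2l// le_measure ?inE; [by []|exact: measurable_cube..|].
  by move=> x /cubeP H; apply/cubeP => i; have := H i; rewrite le_max => /andP[-> ->]; rewrite orbT.
by rewrite [X in (_ * X)%E]lebesgue_cube ?le_max ?lexx// -EFinM ltry.
Qed.

(** The pairings of g with phi and of u with d^w phi agree up to sign. The first is at most M times
    the L^1 norm of g on the support cube of phi. The second has a nonnegative integrand, since d^w
    phi >= c wherever u is nonzero, and this integrand is at least c tau on the inner cube. *)
Lemma weak_derivative_lower_bound w u g phi lo hi r r' c tau M :
  weak_derivative w u g -> localized lo hi phi ->
  0 <= c -> 0 <= tau -> 0 <= r' -> 0 <= M ->
  (forall x, 0 <= u x) -> (forall x, u x != 0 -> cube (- r) r x) ->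
  (forall x, cube (- r') r' x -> tau <= u x) -> r' <= r ->
  (forall x, cube (- r) r x -> c <= iter_partial w phi x) ->
  (forall x, `|phi x| <= M) ->
  ((c * tau * (2 * r') ^+ d)%:E <= M%:E * \int[leb]_(x in cube lo hi) `|g x|%:E)%E.
Proof.
move=> [lu lg /(_ phi) H] locphi c0 tau0 r'0 M0 u0 su utau r'r phic HM.
have := H locphi.1 => {}H.
have [_ /(_ [::])[/= mphi _ sphi]] := locphi.
apply: le_trans (integral_normM_le leb M0 (measurable_cube _ _) lg.1 HM sphi).
have mgphi : measurable_fun setT (fun x => g x * phi x).
  exact: measurable_funM lg.1 mphi.
have B := normr_Rintegral_le leb mgphi.
apply: le_trans B.
have -> : `|\int[leb]_x (g x * phi x)| = `|\int[leb]_x (u x * iter_partial w phi x)|.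
  by rewrite H normrM normrX normrN1 expr1n mul1r.
have uphi0 x : 0 <= u x * iter_partial w phi x.
  have [->|/su /phic cphi] := eqVneq (u x) 0; first by rewrite mul0r.
  by rewrite mulr_ge0// (le_trans c0).
have fin : (\int[leb]_x (u x * iter_partial w phi x)%:E \is a fin_num)%E.
  by apply: integrable_fin_num => //; exact: localized_integrable locphi.
apply: (@le_trans _ _ (\int[leb]_x (u x * iter_partial w phi x)%:E)%E); last first.
  by rewrite -[leLHS]fineK// lee_fin ler_norm.
have -> : ((c * tau * (2 * r') ^+ d)%:E =
    \int[leb]_(x in cube (- r') r') cst (c * tau)%:E x)%E.
  rewrite integral_cst; last exact: measurable_cube.
  have -> : 2 * r' = r' - - r' by ring.
  by rewrite EFinM; congr (_ * _)%E; apply/esym/lebesgue_cube; lra.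
apply: ge0_le_integral_subset => [x _|x _|x xr] /=.
- by rewrite lee_fin mulr_ge0.
- by rewrite lee_fin uphi0.
split=> //; rewrite lee_fin mulrC ler_pM ?utau//; apply: phic.
by move: xr => /cubeP xr; apply/cubeP => i; have := xr i; lra.
Qed.

(** The function d^w psi is supported where u = 0, so its pairing with u vanishes; the sign (-1)^|w|
    is then divided out. *)
Lemma weak_derivative_distant w u g psi lo hi :
  weak_derivative w u g -> localized lo hi psi ->
  (forall x, cube lo hi x -> u x = 0) -> \int[leb]_x (g x * psi x) = 0.
Proof.
move=> [_ _ /(_ psi) H] locpsi u0; have := H locpsi.1.
rewrite [LHS](_ : _ = 0); last first.
  rewrite (_ : (fun x => _) = cst 0) ?/Rintegral ?integral0//.
  apply/funext => x /=; have [->|] := eqVneq (iter_partial w psi x) 0.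
    by rewrite mulr0.
  by have [_ /(_ w)[_ _ spsi]] := locpsi; move=> /spsi /u0 ->; rewrite mul0r.
by move/esym/eqP; rewrite mulf_eq0 signr_eq0/= => /eqP.
Qed.

(** Both psi and g psi are integrable, so the integral of (g(x) - g(y)) psi(y) in y splits, and its
    second part is 0 by assumption. *)
Lemma difference_lower_bound g psi lo hi M x :
  locally_integrable_rV g -> localized lo hi psi -> 0 <= M ->
  (forall x, `|psi x| <= M) -> \int[leb]_y (g y * psi y) = 0 ->
  ((`|g x| * `|\int[leb]_y psi y|)%:E <=
    M%:E * \int[leb]_(y in cube lo hi) `|g x - g y|%:E)%E.
Proof.
move=> lg locpsi M0 HM gpsi0.
have [_ /(_ [::])[/= mpsi _ spsi]] := locpsi.
have mD : measurable_fun setT (fun y => g x - g y).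
  by apply: measurable_funB => //; exact: lg.1.
apply: le_trans (integral_normM_le leb M0 (measurable_cube _ _) mD HM spsi).
have mgpsi : measurable_fun setT (fun y => (g x - g y) * psi y).
  exact: measurable_funM mD mpsi.
apply: le_trans (normr_Rintegral_le leb mgpsi).
rewrite lee_fin -normrM.
have int1 := localized_cst_integrable (g x) [::] locpsi.
have intg := localized_integrable [::] lg locpsi.
have -> : \int[leb]_y ((g x - g y) * psi y) =
    \int[leb]_y (g x * psi y - g y * psi y).
  by apply: eq_Rintegral => y _; rewrite mulrBl.
rewrite RintegralB// gpsi0 subr0 RintegralZl//.
rewrite (_ : EFin \o psi = EFin \o (fun x => 1 * iter_partial [::] psi x)).
  exact: (localized_cst_integrable 1 [::] locpsi).
by apply/funext => y /=; rewrite mul1r.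
Qed.

End weak_derivative_bounds.

(** * From integral bounds to Sobolev and Slobodeckij norms *)

Section norm_bounds.
Context {R : realType}.

Lemma tensor_norm_ge d j (A : tensor j) (w : j.-tuple 'I_d) :
  `|A w| <= @tensor_norm R d j A.
Proof.
rewrite -sqrtr_sqr ler_wsqrtr// (bigD1 w)//= lerDl sumr_ge0// => v _.
exact: sqr_ge0.
Qed.

Lemma enorm_le d (x : 'rV[R]_d) b : 0 <= b ->
  (forall i, `|x ord0 i| <= b) -> enorm x <= d%:R * b.
Proof.
move=> b0 xb; rewrite -[leRHS]ger0_norm ?mulr_ge0// -sqrtr_sqr ler_wsqrtr//.
apply: (@le_trans _ _ (\sum_(i < d) b ^+ 2)).
  by apply: ler_sum => i _; rewrite -real_normK ?num_real// ler_pXn2r ?nnegrE.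
rewrite sumr_const card_ord -[leLHS]mulr_natl exprMn ler_wpM2r ?sqr_ge0//.
by rewrite -natrX ler_nat -mulnn; case: (d) => // k; rewrite leq_pmulr.
Qed.

Lemma le_poweR_inv (k p : R) (X : \bar R) : 0 < p -> 0 <= k ->
  (k%:E <= X)%E -> ((k `^ p^-1)%:E <= X `^ p^-1)%E.
Proof.
move=> p0 k0 kX; rewrite -poweR_EFin gt0_ler_poweR ?invr_ge0 ?(ltW p0)//.
  by rewrite in_itv/= leey andbT lee_fin.
by rewrite in_itv/= leey andbT (le_trans _ kX)// lee_fin.
Qed.

Lemma poweR_inv_le (k p : R) (X : \bar R) : 0 < p -> 0 <= k ->
  ((k `^ p^-1)%:E <= X)%E -> (k%:E <= X `^ p)%E.
Proof.
move=> p0 k0 kX; rewrite -[k in leLHS](@powRr1 _ k)// -(mulVf (lt0r_neq0 p0)).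
rewrite powRrM -poweR_EFin gt0_ler_poweR ?(ltW p0)//.
  by rewrite in_itv/= leey andbT lee_fin powR_ge0.
by rewrite in_itv/= leey andbT (le_trans _ kX)// lee_fin powR_ge0.
Qed.

(** Common to both kinds of seminorm: the kernel exponent e is 0 for integer order and r p + d for
    fractional order. *)
Lemma powR_scaling (C E tau lam p e : R) j k : 0 <= C -> 0 <= tau -> 0 < lam ->
  (C * lam ^- j * tau) `^ p * (E * lam ^+ k / lam `^ e) =
  C `^ p * E * tau `^ p * lam `^ (k%:R - e - j%:R * p).
Proof.
move=> C0 tau0 lam0; rewrite !powRM ?mulr_ge0 ?invr_ge0 ?exprn_ge0 ?(ltW lam0)//.
have -> : (lam ^- j) `^ p = lam `^ (- (j%:R * p)).
  by rewrite -powR_mulrn ?(ltW lam0)// -powRN -powRrM mulNr.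
rewrite -powR_mulrn ?(ltW lam0)// -powRN.
by rewrite !powRD ?(gt_eqF lam0) ?implybT//; ring.
Qed.

End norm_bounds.

Section difference_quotients.
Context {R : realType} {d : nat}.
Local Notation leb := (lebesgue_rV R d).

(** By Tonelli: the inner integral is at least (P / M') |g(x)| by [difference_lower_bound], and the
    outer one is controlled by the assumed L^1 bound. *)
Lemma double_difference_lower_bound (g psi : 'rV[R]_d -> R) (lo hi lo' hi' L M M' P : R) :
  locally_integrable_rV g -> localized lo' hi' psi -> 0 < M -> 0 < M' -> 0 <= P ->
  (forall x, `|psi x| <= M') -> \int[leb]_y (g y * psi y) = 0 ->
  P <= \int[leb]_y psi y ->
  (L%:E <= M%:E * \int[leb]_(x in cube lo hi) `|g x|%:E)%E ->
  ((L * P / (M * M'))%:E <=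
    \int[leb \x leb]_(z in cube lo hi `*` cube lo' hi') `|g z.1 - g z.2|%:E)%E.
Proof.
move=> lg locpsi M0 M'0 P0 HM gpsi0 Ppsi LM.
have mA : measurable (@cube R d lo hi `*` @cube R d lo' hi').
  by apply: measurableX; exact: measurable_cube.
have mf : measurable_fun setT (fun z : 'rV[R]_d * 'rV[R]_d => `|g z.1 - g z.2|%:E).
  apply/measurable_EFinP; apply: measurableT_comp => //; apply: measurable_funB.
    exact: (measurableT_comp lg.1 measurable_fst).
  exact: (measurableT_comp lg.1 measurable_snd).
(* The integrand is set to 0 off the product of cubes, so that Tonelli applies on the whole
   space. *)
rewrite (@integral_mkcond _ _ _ _ (_ `*` _)) fubini_tonelli1; last 2 first.
- by apply/(measurable_restrictT _ mA); exact: measurable_funTS.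
- by move=> z; rewrite patchE; case: ifP.
apply: (@le_trans _ _ (\int[leb]_(x in cube lo hi) ((P / M')%:E * `|g x|%:E))%E).
  rewrite ge0_integralZl//; last 3 first.
  - exact: measurable_cube.
  - by apply/measurable_EFinP; apply: measurableT_comp => //; exact: measurable_funTS lg.1.
  - by rewrite lee_fin divr_ge0// ltW.
  have -> : L * P / (M * M') = P / M' * (M^-1 * L) by field; rewrite !gt_eqF.
  rewrite EFinM lee_wpmul2l ?lee_fin ?divr_ge0 ?(ltW M'0)//.
  by rewrite EFinM lee_pdivrMl.
apply: ge0_le_integral_subset => [x _|x _|x xQ].
- by rewrite -EFinM lee_fin mulr_ge0 ?divr_ge0 ?(ltW M'0).
- by apply: integral_ge0 => y _; rewrite patchE; case: ifP.
split=> //.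
have -> : fubini_F leb ((fun z => `|g z.1 - g z.2|%:E) \_ (cube lo hi `*` cube lo' hi')) x
   = (\int[leb]_(y in cube lo' hi') `|g x - g y|%:E)%E.
  rewrite [RHS]integral_mkcond; apply: eq_integral => y _.
  rewrite !patchE; congr (if _ then _ else _).
  by apply/idP/idP => /set_mem H; apply/mem_set; [case: H|split].
rewrite -EFinM [P / M']mulrC -mulrA EFinM lee_pdivrMl//.
apply: le_trans (difference_lower_bound x lg locpsi (ltW M'0) HM gpsi0).
by rewrite lee_fin mulrC ler_wpM2l// (le_trans Ppsi)// ler_norm.
Qed.

Lemma Rintegral_localized_ge (psi : 'rV[R]_d -> R) lo hi l h c :
  localized lo hi psi -> (forall x, 0 <= psi x) -> 0 <= c -> l <= h ->
  (forall x, cube l h x -> c <= psi x) ->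
  c * (h - l) ^+ d <= \int[leb]_x psi x.
Proof.
move=> locpsi psi0 c0 lh cpsi.
have := localized_cst_integrable 1 [::] locpsi.
rewrite (_ : EFin \o _ = EFin \o psi); last by apply/funext => x /=; rewrite mul1r.
move=> /integrable_fin_num /= /(_ measurableT) fin.
rewrite -lee_fin fineK// EFinM -lebesgue_cube// -integral_cst; last exact: measurable_cube.
apply: ge0_le_integral_subset => [x _|x _|x xl] /=; rewrite ?lee_fin//.
by split => //; exact: cpsi.
Qed.

End difference_quotients.

Section seminorm_bounds.
Context {R : realType}.

Lemma Lnorm_tensor_lower_bound d j (G : 'rV[R]_d -> tensor j) (w : j.-tuple 'I_d)
    (p a lo hi : R) :
  measurable_fun setT (fun x => G x w) -> 1 <= p -> 0 <= a -> lo <= hi ->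
  ((2 * a * (hi - lo) ^+ d)%:E <=
    \int[lebesgue_rV R d]_(x in cube lo hi) `|G x w|%:E)%E ->
  (((a `^ p * (hi - lo) ^+ d) `^ p^-1)%:E <=
    Lnorm (lebesgue_rV R d) p%:E (fun x => (tensor_norm (G x))%:E))%E.
Proof.
move=> mG p1 a0 lohi H; have p0 : 0 < p by rewrite (lt_le_trans _ p1).
rewrite unlock; apply: le_poweR_inv => //.
  by rewrite mulr_ge0 ?powR_ge0 ?exprn_ge0 ?subr_ge0.
have mGQ : measurable_fun (cube lo hi) (fun x => `|G x w|).
  by apply: measurableT_comp => //; exact: measurable_funTS.
have := power_mean (measurable_cube lo hi) mGQ (fun x _ => normr_ge0 _) p1 a0
  (lebesgue_cube d lohi) H.
move=> /le_trans; apply; apply: ge0_le_integral_subset => [x _|x _|x _].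
- by rewrite lee_fin powR_ge0.
- exact: poweR_ge0.
split=> //; rewrite poweR_EFin lee_fin ge0_ler_powR ?nnegrE ?(ltW p0)//.
by rewrite ger0_norm ?sqrtr_ge0 ?tensor_norm_ge.
Qed.

(** On the two separated cubes |x - y| is at most d D, so the kernel is at least (d D)^-(r p + d).
    What remains is [power_mean] for the difference of a single component. *)
Lemma slobodeckij_lower_bound d j (G : 'rV[R]_d -> tensor j) (w : j.-tuple 'I_d)
    (r p a lo hi lo' hi' D : R) :
  measurable_fun setT (fun x => G x w) -> 1 <= p -> 0 <= r -> 0 <= a ->
  lo <= hi -> hi < lo' -> lo' <= hi' -> (0 < d)%N -> hi' - lo <= D ->
  ((2 * a * ((hi - lo) ^+ d * (hi' - lo') ^+ d))%:E <=
    \int[lebesgue_rV R d \x lebesgue_rV R d]_(z in cube lo hi `*` cube lo' hi')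
      `|G z.1 w - G z.2 w|%:E)%E ->
  (((a `^ p * ((hi - lo) ^+ d * (hi' - lo') ^+ d) / (d%:R * D) `^ (r * p + d%:R))
     `^ p^-1)%:E <= slobodeckij_seminorm r p G)%E.
Proof.
move=> mG p1 r0 a0 lohi hilo' lohi' d0 HD H.
have p0 : 0 < p by rewrite (lt_le_trans _ p1).
have D0 : 0 < D by lra.
have dD0 : 0 < d%:R * D by rewrite mulr_gt0 ?ltr0n.
set e := r * p + d%:R; have e0 : 0 < e.
  by rewrite ltr_wpDl ?ltr0n// mulr_ge0// ltW.
have mA : measurable (@cube R d lo hi `*` @cube R d lo' hi').
  by apply: measurableX; exact: measurable_cube.
have mf : measurable_fun (@cube R d lo hi `*` @cube R d lo' hi')
    (fun z : 'rV[R]_d * 'rV[R]_d => `|G z.1 w - G z.2 w|).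
  apply: measurable_funTS; apply: measurableT_comp => //; apply: measurable_funB.
    exact: (measurableT_comp mG measurable_fst).
  exact: (measurableT_comp mG measurable_snd).
have AV : (lebesgue_rV R d \x lebesgue_rV R d)%E (@cube R d lo hi `*` @cube R d lo' hi')
   = ((hi - lo) ^+ d * (hi' - lo') ^+ d)%:E.
  rewrite product_measure1E; [|exact: measurable_cube..].
  by rewrite EFinM; congr (_ * _)%E; exact: lebesgue_cube.
apply: le_poweR_inv => //.
  by rewrite divr_ge0 ?mulr_ge0 ?powR_ge0 ?exprn_ge0 ?subr_ge0.
rewrite mulrC EFinM lee_pdivrMl ?powR_gt0//.
have := power_mean mA mf (fun x _ => normr_ge0 _) p1 a0 AV H.
move=> /le_trans; apply.
rewrite -lee_pdivrMl ?powR_gt0// -ge0_integralZl ?lee_fin ?invr_ge0 ?powR_ge0//; last first.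
  by apply/measurable_EFinP; exact: (measurableT_comp (measurable_powR p) mf).
apply: ge0_le_integral_subset => [z _|z _|[x y] [/= /cubeP xQ /cubeP yQ]].
- by rewrite -EFinM lee_fin mulr_ge0 ?invr_ge0 ?powR_ge0.
- by rewrite lee_fin divr_ge0 ?powR_ge0.
split=> //; rewrite -EFinM lee_fin mulrC ler_pM ?invr_ge0 ?powR_ge0//.
  rewrite ge0_ler_powR ?nnegrE ?sqrtr_ge0 ?(ltW p0)//.
  by have := tensor_norm_ge (G x - G y) w; rewrite !ffunE.
(* Inversion reverses the order of positive numbers only, and the inverse of 0 is 0; the gap hi <
   lo' keeps x - y away from 0. *)
have xy0 : 0 < enorm (x - y).
  rewrite sqrtr_gt0 (bigD1 (Ordinal d0))//= ltr_wpDr//.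
    by apply: sumr_ge0 => i _; exact: sqr_ge0.
  rewrite exprn_even_gt0//= !mxE subr_eq0 lt_eqF//.
  by have /andP[_ ?] := xQ (Ordinal d0); have /andP[? _] := yQ (Ordinal d0); lra.
rewrite lef_pV2 ?posrE ?powR_gt0// ge0_ler_powR ?nnegrE ?(ltW e0) ?(ltW xy0) ?(ltW dD0)//.
apply: enorm_le => [|i]; first exact: ltW.
have /andP[? ?] := xQ i; have /andP[? ?] := yQ i.
by rewrite !mxE ler_norml; apply/andP; split; lra.
Qed.

End seminorm_bounds.

(** * Powers of the scale and matching of constants *)

Section scaling_identities.
Context {R : realType}.

Lemma Lnorm_scaling (q tau lam p s B : R) j d : 0 <= q -> 0 <= tau -> 0 < lam ->
  s = j%:R ->
  q `^ p * (2 * B) ^+ d * tau `^ p * lam `^ (d%:R - s * p) =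
  (q * lam ^- j * tau) `^ p * (B * lam - - (B * lam)) ^+ d.
Proof.
move=> q0 tau0 lam0 ->.
have -> : (B * lam - - (B * lam)) ^+ d = (2 * B) ^+ d * lam ^+ d / lam `^ 0.
  by rewrite powRr0 divr1 -exprMn; congr (_ ^+ _); ring.
by rewrite powR_scaling// subr0.
Qed.

Lemma slobodeckij_scaling (q tau lam p s r B B' a D : R) j d :
  0 <= q -> 0 <= tau -> 0 < lam -> 0 <= D -> s = j%:R + r ->
  q `^ p * ((2 * B) ^+ d * (B' - a) ^+ d / (d%:R * D) `^ (r * p + d%:R)) *
    tau `^ p * lam `^ (d%:R - s * p) =
  (q * lam ^- j * tau) `^ p * ((B * lam - - (B * lam)) ^+ d *
    (B' * lam - a * lam) ^+ d) / (d%:R * (D * lam)) `^ (r * p + d%:R).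
Proof.
move=> q0 tau0 lam0 D0 ->.
have -> : (B * lam - - (B * lam)) ^+ d = (2 * B) ^+ d * lam ^+ d.
  by rewrite -exprMn; congr (_ ^+ _); ring.
rewrite -mulrBl [((_ - a) * lam) ^+ d]exprMn [d%:R * (D * _)]mulrA.
rewrite [(d%:R * D * lam) `^ _]powRM ?mulr_ge0 ?(ltW lam0)//.
set X := (2 * B) ^+ d; set Y := (B' - a) ^+ d.
set Z := (d%:R * D) `^ _; set W := lam `^ (r * p + d%:R).
transitivity ((q * lam ^- j * tau) `^ p * (X * Y / Z * lam ^+ (d + d) / W)).
  rewrite powR_scaling//; congr (_ * _ `^ _).
  by rewrite natrD; ring.
by rewrite exprD invfM; ring.
Qed.

(** This dictates the level [a] in [power_mean] for integer order: 2 a times the volume of the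
    support cube is exactly the duality bound divided by M. *)
Lemma Lnorm_constant (c tau lam rho' M B : R) j d : 0 < lam -> 0 < B -> 0 < M ->
  2 * (c * (rho' / B) ^+ d / (2 * M) * lam ^- j * tau) * (B * lam - - (B * lam)) ^+ d =
  M^-1 * (c * lam ^- j * tau * (2 * (rho' * lam)) ^+ d).
Proof.
move=> lam0 B0 M0; have -> : B * lam - - (B * lam) = 2 * B * lam by ring.
rewrite !exprMn exprVn; field.
by rewrite !expf_neq0 ?gt_eqF.
Qed.

(** The fractional counterpart: 2 a times the product of the two cube volumes is exactly the bound
    of [double_difference_lower_bound]. *)
Lemma slobodeckij_constant (c c' tau lam rho' M M' B B' a h l : R) j d :
  0 < lam -> 0 < B -> 0 < M -> 0 < M' -> 0 < B' - a ->
  2 * (c * (rho' / B) ^+ d / (2 * M) * (c' * (h - l) ^+ d) / (M' * (B' - a) ^+ d)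
    * lam ^- j * tau) *
    ((B * lam - - (B * lam)) ^+ d * (B' * lam - a * lam) ^+ d) =
  c * lam ^- j * tau * (2 * (rho' * lam)) ^+ d *
    (c' * (h * lam - l * lam) ^+ d) / (M * M').
Proof.
move=> lam0 B0 M0 M'0 B'a0; have -> : B * lam - - (B * lam) = 2 * B * lam by ring.
rewrite -!mulrBl !exprMn exprVn; field.
by rewrite !expf_neq0 ?gt_eqF.
Qed.

End scaling_identities.

(** [K] is uniform because the cutoffs exist at every scale with the same constants. Bounding every
    representative bounds the infimum, which is +oo if there is none. *)
Lemma sobolev_norm_lower_bound (R : realType) d (s p rho rho' : R) : (0 < d)%N ->
  0 <= s -> 1 <= p -> 0 < rho' -> rho' <= rho ->
  exists2 K : R, 0 < K & forall (lam tau : R) (u : 'rV[R]_d -> R),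
    0 < lam -> 0 <= tau -> (forall x, 0 <= u x) ->
    (forall x, u x != 0 -> cube (- (rho * lam)) (rho * lam) x) ->
    (forall x, cube (- (rho' * lam)) (rho' * lam) x -> tau <= u x) ->
    ((K * tau `^ p * lam `^ (d%:R - s * p))%:E <= sobolev_norm s p u `^ p)%E.
Proof.
case: d => // n _ s0 p1 rho'0 rho'rho; have p0 : 0 < p by rewrite (lt_le_trans _ p1).
have rho0 : 0 < rho by rewrite (lt_le_trans rho'0).
set j := Num.truncn s; set r := s - j%:R.
have r0 : 0 <= r by rewrite subr_ge0 truncn_le.
have [c [M [B [c0 M0 B0 Hphi]]]] := @cutoff_function R n j rho rho0.
(* The radius rho + B puts psi beyond the support of u, where the pairing with psi vanishes, and
   beyond the cube of phi, so that the two cubes are separated. *)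
have [c' [M' [a [l [h [B' [[c'0 M'0 /andP[rhoa al] /andP[lh hB']] Hpsi]]]]]]] :=
  @distant_cutoff_function R n (rho + B) (addr_gt0 rho0 B0).
pose d := n.+1.
(* [q] and, below, [q'] are the scale-free constants for which the levels q lam^-j tau and q' lam^-j
   tau match the available integral bounds exactly. *)
pose q := c * (rho' / B) ^+ d / (2 * M).
have q0 : 0 < q by rewrite divr_gt0 ?mulr_gt0 ?exprn_gt0 ?divr_gt0.
pose q' := q * (c' * (h - l) ^+ d) / (M' * (B' - a) ^+ d).
have B'a0 : 0 < B' - a by lra.
have hl0 : 0 < h - l by lra.
have q'0 : 0 < q'.
  exact: (divr_gt0 (mulr_gt0 q0 (mulr_gt0 c'0 (exprn_gt0 _ hl0))) (mulr_gt0 M'0 (exprn_gt0 _ B'a0))).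
pose K := if r == 0 then q `^ p * (2 * B) ^+ d
  else q' `^ p * ((2 * B) ^+ d * (B' - a) ^+ d / (d%:R * (B' + B)) `^ (r * p + d%:R)).
have dB0 : 0 < d%:R * (B' + B) by rewrite mulr_gt0 ?ltr0n//; lra.
have K0 : 0 < K.
  have B20 : 0 < 2 * B by lra.
  rewrite /K; case: ifP => _; first by rewrite mulr_gt0 ?powR_gt0 ?exprn_gt0.
  by rewrite mulr_gt0 ?powR_gt0// divr_gt0 ?powR_gt0// mulr_gt0 ?exprn_gt0.
exists K => //.
move=> lam tau u lam0 tau0 u0 su utau.
have [phi [locphi phic phiM]] := Hphi _ lam0.
have [psi [locpsi /all_and2[psi0 psiM] psic]] : exists psi : 'rV[R]_n.+1 -> R,
    [/\ localized (a * lam) (B' * lam) psi, forall x, 0 <= psi x /\ psi x <= M'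
    & forall x, cube (l * lam) (h * lam) x -> c' <= psi x].
  have [psi [? H ?]] := Hpsi _ lam0; exists psi; split=> // x.
  by apply/andP.
apply: poweR_inv_le => //.
  by rewrite !mulr_ge0 ?powR_ge0// ltW.
apply: le_ereal_inf_tmp => _ [G wG ->].
pose w0 := nseq_tuple j (ord0 : 'I_n.+1).
have wG0 : weak_derivative (nseq j ord0) u (fun x => G x w0) := wG w0.
have lg : locally_integrable_rV (fun x => G x w0) by case: wG0.
have rl' : 0 <= rho' * lam by rewrite mulr_ge0// ltW.
have rr : rho' * lam <= rho * lam by rewrite ler_pM2r.
have cl0 : 0 <= c * lam ^- j by rewrite mulr_ge0 ?invr_ge0 ?exprn_ge0 ?ltW.
have L1 := weak_derivative_lower_bound wG0 locphi cl0 tau0 rl' (ltW M0) u0 su utau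
  rr phic phiM.
have BB : - (B * lam) <= B * lam by rewrite ge0_cp// mulr_ge0 ?ltW.
case: ifPn => [r_eq0|r_neq0].
- have KE : K = q `^ p * (2 * B) ^+ d by rewrite /K ifT.
  have sj : s = j%:R by apply/eqP; rewrite -subr_eq0.
  rewrite KE (Lnorm_scaling p B d (ltW q0) tau0 lam0 sj).
  apply: Lnorm_tensor_lower_bound => //; first exact: lg.1.
    by rewrite mulr_ge0// mulr_ge0 ?(ltW q0)// invr_ge0 exprn_ge0 ?ltW.
  move: L1; rewrite -lee_pdivrMl// -EFinM; apply: le_trans; rewrite lee_fin.
  by rewrite (Lnorm_constant c tau rho' j d lam0 B0 M0).
- have KE : K = q' `^ p * ((2 * B) ^+ d * (B' - a) ^+ d /
      (d%:R * (B' + B)) `^ (r * p + d%:R)) by rewrite /K ifN.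
  have sjr : s = j%:R + r by rewrite /r addrC subrK.
  have BB0 : 0 <= B' + B by lra.
  rewrite KE (slobodeckij_scaling p B B' a d (ltW q'0) tau0 lam0 BB0 sjr).
  apply: slobodeckij_lower_bound => //; first exact: lg.1.
  + by rewrite mulr_ge0// mulr_ge0 ?(ltW q'0)// invr_ge0 exprn_ge0 ?ltW.
  + by rewrite ltr_pM2r//; lra.
  + by rewrite ler_pM2r//; lra.
  + by lra.
  have distant x : cube (a * lam) (B' * lam) x -> u x = 0.
    move=> /cubeP xc; apply/eqP; apply: contraT => /su /cubeP ux.
    have /andP[_ ?] := ux ord0; have /andP[? _] := xc ord0.
    have : (rho + B) * lam < a * lam by rewrite ltr_pM2r.
    have : 0 < B * lam by rewrite mulr_gt0.
    lra.
  have lhlam : l * lam <= h * lam by rewrite ler_pM2r// ltW.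
  have psi_gt0 := Rintegral_localized_ge locpsi psi0 (ltW c'0) lhlam psic.
  have psiM' x : `|psi x| <= M' by rewrite ger0_norm.
  have P0 : 0 <= c' * (h * lam - l * lam) ^+ d.
    by rewrite mulr_ge0 ?(ltW c'0)// exprn_ge0// subr_ge0.
  have := double_difference_lower_bound lg locpsi M0 M'0 P0 psiM'
    (weak_derivative_distant wG0 locpsi distant) psi_gt0 L1.
  apply: le_trans; rewrite lee_fin.
  by rewrite (slobodeckij_constant c c' tau rho' h l j d lam0 B0 M0 M'0 B'a0).
Qed.

(** * The Barenblatt solution *)

Section barenblatt_bounds.
Context {R : realType}.

Lemma signed_powE (mu v : R) : 0 < mu -> 0 <= v -> signed_pow mu v = v `^ mu.
Proof. by move=> mu0 v0; rewrite /signed_pow ger0_norm// mulrC mulr_powRB1. Qed.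

Lemma normr_coord_le_enorm d (x : 'rV[R]_d) i : `|x ord0 i| <= enorm x.
Proof.
rewrite -sqrtr_sqr ler_wsqrtr// (bigD1 i)//= lerDl sumr_ge0// => k _.
exact: sqr_ge0.
Qed.

Lemma barenblatt_ge0 d (m C t : R) (x : 'rV[R]_d) : 0 <= barenblatt m C t x.
Proof. by rewrite mulr_ge0// powR_ge0. Qed.

Lemma BB_constants d (m : R) : (1 <= d)%N -> 1 < m ->
  [/\ 0 < BB_alpha d m, 0 < BB_k d m & BB_beta d m = (d%:R * (m - 1) + 2)^-1].
Proof.
move=> d1 m1; have d0 : 0 < d%:R :> R by rewrite ltr0n.
have Q0 : 0 < d%:R * (m - 1) + 2 by rewrite ltr_wpDl// mulr_ge0 ?ltW ?subr_gt0.
have a0 : 0 < BB_alpha d m by rewrite divr_gt0.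
have m0 : 0 < 2 * m by lra.
have m10 : 0 < m - 1 by lra.
split=> //; first exact: (divr_gt0 (mulr_gt0 a0 m10) (mulr_gt0 m0 d0)).
by rewrite /BB_beta /BB_alpha mulrAC divff ?mul1r ?gt_eqF.
Qed.

Lemma barenblatt_support d (m C t : R) (x : 'rV[R]_d) : (1 <= d)%N -> 1 < m ->
  0 < C -> 0 < t -> barenblatt m C t x != 0 ->
  let rho := Num.sqrt (C / BB_k d m) * t `^ BB_beta d m in cube (- rho) rho x.
Proof.
move=> d1 m1 C0 t0 H; have [_ k0 _] := BB_constants d1 m1.
apply/cubeP => i; rewrite -ler_norml leNgt; apply/negP => ltx.
move: H; apply/negP; rewrite negbK mulf_eq0; apply/orP; right.
(* The power of 0 is 0 because the exponent 1/(m - 1) is nonzero; with exponent 0 it would be 1. *)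
rewrite (_ : Num.max _ _ = 0).
  by rewrite powR0 ?eqxx// invr_eq0 subr_eq0 gt_eqF.
apply/max_idPr; rewrite subr_le0 mulrC -ler_pdivrMr//.
have Ck : 0 <= C / BB_k d m by rewrite divr_ge0 ?ltW.
rewrite -(sqr_sqrtr Ck) ler_pXn2r ?nnegrE ?sqrtr_ge0//.
apply: le_trans (normr_coord_le_enorm _ i).
rewrite mxE powRN normrM normfV (ger0_norm (powR_ge0 _ _)) [leRHS]mulrC.
by rewrite ler_pdivlMr ?powR_gt0// ltW.
Qed.

(** The Euclidean norm is at most d times the largest coordinate, so the radius rho / (2 d) gives |x
    t^-beta| <= rho / 2. Then k |x t^-beta|^2 <= C / 4, and the bracket is at least C / 2. *)
Lemma barenblatt_lower_bound d (m C t : R) (x : 'rV[R]_d) : (1 <= d)%N -> 1 < m ->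
  0 < C -> 0 < t ->
  let r := Num.sqrt (C / BB_k d m) / (2 * d%:R) * t `^ BB_beta d m in
  cube (- r) r x ->
  t `^ (- BB_alpha d m) * (C / 2) `^ (m - 1)^-1 <= barenblatt m C t x.
Proof.
move=> d1 m1 C0 t0 r /cubeP xr; have [_ k0 _] := BB_constants d1 m1.
have d0 : 0 < d%:R :> R by rewrite ltr0n.
rewrite ler_wpM2l ?powR_ge0// ge0_ler_powR ?nnegrE ?invr_ge0 ?subr_ge0 ?(ltW m1)//.
- by rewrite divr_ge0 ?ltW.
- by rewrite le_max lexx orbT.
rewrite le_max; apply/orP; left.
set rho := Num.sqrt _ in r xr.
have rho0 : 0 <= rho by exact: sqrtr_ge0.
have : enorm (t `^ (- BB_beta d m) *: x) <= d%:R * (rho / (2 * d%:R)).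
  apply: enorm_le => [|i]; first by rewrite divr_ge0// mulr_ge0// ltW.
  rewrite mxE powRN normrM normfV (ger0_norm (powR_ge0 _ _)) [leLHS]mulrC.
  by rewrite ler_pdivrMr ?powR_gt0// ler_norml xr.
have -> : d%:R * (rho / (2 * d%:R)) = rho / 2 by field; rewrite gt_eqF.
move=> He; have : enorm (t `^ (- BB_beta d m) *: x) ^+ 2 <= (rho / 2) ^+ 2.
  by rewrite ler_pXn2r ?nnegrE ?sqrtr_ge0// divr_ge0.
have rho2 : rho ^+ 2 = C / BB_k d m by rewrite sqr_sqrtr// divr_ge0 ?ltW.
rewrite exprMn rho2 => /(ler_wpM2l (ltW k0)).
have -> : BB_k d m * (C / BB_k d m * 2^-1 ^+ 2) = C / 4 by field; rewrite gt_eqF.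
lra.
Qed.

Lemma continuous_inv_itv (e b : R) : 0 < e -> {within `[e, b], continuous (@GRing.inv R)}.
Proof.
move=> e0; apply: continuous_in_subspaceT => x; rewrite inE/= in_itv/= => /andP[ex _].
by apply: cvgV; [rewrite gt_eqF// (lt_le_trans e0)|exact: cvg_id].
Qed.

Lemma integral_inv_itv (e b : R) : 0 < e -> e < b ->
  (\int[lebesgue_measure]_(t in `[e, b]) (t^-1)%:E = (ln b - ln e)%:E)%E.
Proof.
move=> e0 eb.
have cvg_ln (x : R) : 0 < x -> ln y @[y --> x] --> ln x.
  move=> x0; apply: differentiable_continuous; apply/derivable1_diffP.
  by case: (is_derive1_ln x0).
rewrite (@continuous_FTC2 _ _ (@ln R))//.
- exact: continuous_inv_itv.
- split.
  + move=> x; rewrite in_itv/= => /andP[ex _].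
    by case: (is_derive1_ln (lt_trans e0 ex)).
  + exact/cvg_at_right_filter/cvg_ln.
  + by apply/cvg_at_left_filter/cvg_ln; exact: lt_trans eb.
- move=> x; rewrite in_itv/= => /andP[ex _]; rewrite derive1E.
  by case: (is_derive1_ln (lt_trans e0 ex)).
Qed.

Lemma integral_inv_pinfty (T K : R) (F : R -> \bar R) : 0 < T -> 0 < K ->
  (forall t, 0 <= F t)%E ->
  (forall t, 0 < t -> t < T -> ((K * t^-1)%:E <= F t)%E) ->
  (\int[lebesgue_measure]_(t in `]0%R, T[) F t = +oo)%E.
Proof.
move=> T0 K0 F0 KF.
have lower (A : R) : 0 < A -> (A%:E <= \int[lebesgue_measure]_(t in `]0%R, T[) F t)%E.
  (* [e] solves K ln(b / e) = A, so the integral of K / t over [e, b] is exactly A, while b = T / 2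
     keeps the interval inside (0, T). *)
  move=> A0; pose b := T / 2; pose e := b * expR (- (A / K)).
  have b0 : 0 < b by rewrite divr_gt0.
  have e0 : 0 < e by rewrite mulr_gt0 ?expR_gt0.
  have eb : e < b by rewrite gtr_pMr// -expR0 ltr_expR oppr_lt0 divr_gt0.
  have AE : A%:E = (\int[lebesgue_measure]_(t in `[e, b]) (K%:E * (t^-1)%:E))%E.
    rewrite ge0_integralZl//; last 3 first.
    + apply/measurable_EFinP; apply: subspace_continuous_measurable_fun => //.
      exact: continuous_inv_itv.
    + move=> t /=; rewrite in_itv/= => /andP[et _].
      by rewrite lee_fin invr_ge0 (le_trans (ltW e0)).
    + by rewrite lee_fin ltW.
    rewrite integral_inv_itv// /e lnM ?posrE ?expR_gt0// expRK -EFinM; congr EFin.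
    by field; rewrite gt_eqF.
  rewrite AE; apply: ge0_le_integral_subset => t //=.
    rewrite in_itv/= => /andP[et _].
    by rewrite -EFinM lee_fin mulr_ge0 ?invr_ge0 ?(ltW K0)// (le_trans (ltW e0)).
  rewrite in_itv/= => /andP[et tb]; have t0 := lt_le_trans e0 et.
  have tT : t < T by rewrite (le_lt_trans tb)// /b; lra.
  by rewrite in_itv/= t0 tT -EFinM; split=> //; exact: KF.
move: lower; case: integral => [x| |] lower //.
- have A0 : 0 < `|x| + 1 by rewrite ltr_wpDl.
  have := lower _ A0; rewrite lee_fin leNgt => /negP[].
  by rewrite (le_lt_trans (ler_norm x))// ltrDl.
- by have := lower 1 ltr01.
Qed.

End barenblatt_bounds.

(** With Q = d (m - 1) + 2 the exponent is -(d (m - 1) + s m / mu) / Q, and s m / mu >= 2. *)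
Lemma barenblatt_exponent (R : realType) (d : nat) (m mu s : R) :
  (1 <= d)%N -> 1 < m -> 1 <= mu -> 2 * mu / m <= s ->
  - BB_alpha d m * m + BB_beta d m * (d%:R - s * (m / mu)) <= -1.
Proof.
move=> d1 m1 mu1 Hs; have [_ _ bE] := BB_constants d1 m1.
have d0 : 0 < d%:R :> R by rewrite ltr0n.
have Q0 : 0 < d%:R * (m - 1) + 2 by rewrite ltr_wpDl// mulr_ge0 ?ltW ?subr_gt0.
have H2 : 2 <= s * (m / mu).
  by move: Hs; rewrite ler_pdivrMr ?(lt_trans _ m1)// mulrA ler_pdivlMr// (lt_le_trans _ mu1).
rewrite bE /BB_alpha; set Q := _ + 2 in Q0 *.
have -> : - (d%:R / Q) * m + Q^-1 * (d%:R - s * (m / mu)) =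
    (- d%:R * m + d%:R - s * (m / mu)) / Q by ring.
rewrite ler_pdivrMr// /Q; lra.
Qed.

Lemma time_lower_bound (R : realType) (K c t alpha beta mu m e : R) :
  0 < t -> t <= 1 -> 0 <= K -> 0 <= c -> 0 < mu -> - alpha * m + beta * e <= -1 ->
  K * c `^ m * t^-1 <=
    K * ((t `^ (- alpha) * c) `^ mu) `^ (m / mu) * (t `^ beta) `^ e.
Proof.
move=> t0 t1 K0 c0 mu0 H; rewrite -!powRrM.
have -> : mu * (m / mu) = m by field; rewrite gt_eqF.
rewrite powRM ?powR_ge0// -powRrM -!mulrA ler_wpM2l// mulrCA ler_wpM2l ?powR_ge0//.
rewrite -powRD ?(gt_eqF t0) ?implybT// -powR_inv1 ?(ltW t0)//.
by apply: ger_powR => //; rewrite t0.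
Qed.

Theorem mainTheorem5 (R : realType) (d : nat) (m T C mu s : R)
  (d_ge1 : (1 <= d)%N) (m_gt1 : 1 < m) (T_gt0 : 0 < T) (C_gt0 : 0 < C)
  (mu_ge1 : 1 <= mu) (mu_le_m : mu <= m) (s_gt0 : 0 < s) :
  Lp_sobolev T s (m / mu)
    (fun (t : R) (x : 'rV[R]_d) => signed_pow mu (barenblatt m C t x)) ->
  s < 2 * mu / m.
Proof.
move=> [_ _ finT]; rewrite ltNge; apply/negP => Hs.
have mu0 : 0 < mu by rewrite (lt_le_trans _ mu_ge1).
have p1 : 1 <= m / mu by rewrite ler_pdivlMr// mul1r.
have [a0 k0 bE] := BB_constants d_ge1 m_gt1.
pose rho := Num.sqrt (C / BB_k d m).
have rho_gt0 : 0 < rho by rewrite sqrtr_gt0 divr_gt0.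
have rho'_gt0 : 0 < rho / (2 * d%:R) by rewrite divr_gt0// mulr_gt0// ltr0n.
have rho'_le : rho / (2 * d%:R) <= rho.
  rewrite ler_pdivrMr ?mulr_gt0 ?ltr0n// ler_peMr ?(ltW rho_gt0)//.
  have : 1 <= d%:R :> R by rewrite ler1n.
  lra.
have [K K0 HK] := @sobolev_norm_lower_bound R d s (m / mu) rho (rho / (2 * d%:R))
  d_ge1 (ltW s_gt0) p1 rho'_gt0 rho'_le.
pose c1 := (C / 2) `^ (m - 1)^-1.
have c1_gt0 : 0 < c1 by rewrite powR_gt0// divr_gt0.
have Kc : 0 < K * c1 `^ m by rewrite mulr_gt0// powR_gt0.
pose F t := (sobolev_norm s (m / mu) (fun x : 'rV[R]_d =>
  signed_pow mu (barenblatt m C t x)) `^ (m / mu))%E.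
(* The norm bound is used with lam = t^beta and tau = (t^-alpha c1)^mu. For t < 1 a power of t with
   exponent at most -1 dominates 1 / t, hence the restriction to min(T, 1). *)
have lowerF t : 0 < t -> t < Num.min T 1 -> ((K * c1 `^ m * t^-1)%:E <= F t)%E.
  rewrite lt_min => t0 /andP[_ t1].
  have la0 : 0 < t `^ BB_beta d m by rewrite powR_gt0.
  have tau0 : 0 <= (t `^ (- BB_alpha d m) * c1) `^ mu by rewrite powR_ge0.
  have u0 (x : 'rV[R]_d) : 0 <= signed_pow mu (barenblatt m C t x).
    by rewrite signed_powE ?powR_ge0// barenblatt_ge0.
  have su (x : 'rV[R]_d) : signed_pow mu (barenblatt m C t x) != 0 ->
      cube (- (rho * t `^ BB_beta d m)) (rho * t `^ BB_beta d m) x.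
    move=> ux; apply: barenblatt_support => //.
    by move: ux; apply: contraNN => /eqP ->; rewrite /signed_pow mulr0.
  have utau (x : 'rV[R]_d) : cube (- (rho / (2 * d%:R) * t `^ BB_beta d m))
      (rho / (2 * d%:R) * t `^ BB_beta d m) x ->
      (t `^ (- BB_alpha d m) * c1) `^ mu <= signed_pow mu (barenblatt m C t x).
    move=> /(barenblatt_lower_bound d_ge1 m_gt1 C_gt0 t0) lex.
    rewrite (signed_powE mu0 (barenblatt_ge0 m C t x)).
    have v0 : 0 <= t `^ (- BB_alpha d m) * c1 by rewrite mulr_ge0 ?powR_ge0.
    exact: (ge0_ler_powR (ltW mu0) v0 (le_trans v0 lex) lex).
  apply: le_trans (HK _ _ _ la0 tau0 u0 su utau); rewrite lee_fin.
  exact: (time_lower_bound t0 (ltW t1) (ltW K0) (ltW c1_gt0) mu0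
    (barenblatt_exponent d_ge1 m_gt1 mu_ge1 Hs)).
have Tmin : 0 < Num.min T 1 by rewrite lt_min T_gt0 ltr01.
have F0 t : (0 <= F t)%E by exact: poweR_ge0.
have := integral_inv_pinfty Tmin Kc F0 lowerF.
move=> Foo; move: finT; apply/negP; rewrite -leNgt -Foo.
apply: ge0_le_integral_subset => [t _|t _|t /=]; rewrite ?F0 ?poweR_ge0//.
by rewrite !in_itv/= lt_min => /andP[-> /andP[-> _]].
Qed.
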